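(* For every fixed $d,m_1,\dots,m_d$, there is an algorithm that, given $n$, integer line-sums $v=((v_{*,i_2,\dots,i_{d+1}}),\dots,(v_{i_1,\dots,i_d,*}))$, and an entry index $(k_1,\dots,k_{d+1})$, solves, in time which is polynomial in $n$ and $\langle v\rangle$, the corresponding entry uniqueness problem, of deciding if the entry $x_{k_1,\dots,k_{d+1}}$ is the same in all $(d+1)$-tables in the set $$S:=\left\{x\in\mathbb{Z}_+^{m_1\times\cdots\times m_d\times n}\ :\ \sum_{i_1}x_{i_1,\dots,i_{d+1}}=v_{*,i_2,\dots,i_{d+1}},\ \dots,\ \sum_{i_{d+1}}x_{i_1,\dots,i_{d+1}}=v_{i_1,\dots,i_d,*}\right\}.$$
   Context: Here $d,m_1,\dots,m_d,n$ are positive integers, $\mathbb{Z}_+$ is the set of nonnegative integers, and arrays (tables) $x=(x_{i_1,\dots,i_{d+1}})$ are indexed by $1\le i_j\le m_j$ for $j=1,\dots,d$ and $1\le i_{d+1}\le n$. For each of the $d+1$ coordinates $j$, there is one line-sum equation for every choice of the other $d$ indices, requiring that the sum of $x_{i_1,\dots,i_{d+1}}$ over $i_j$ equal the prescribed integer $v_{i_1,\dots,i_{j-1},*,i_{j+1},\dots,i_{d+1}}$. $\langle\cdot\rangle$ denotes binary-encoding length. *)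

(* Defs.v *)
From mathcomp Require Import all_boot all_order all_algebra.

Set Implicit Arguments.
Unset Strict Implicit.
Unset Printing Implicit Defensive.

Import GRing.Theory Num.Theory.
Local Open Scope ring_scope.

(** Binary length of an integer: 1 + ceil (log2 (|z| + 1)), the additional bit
    being the sign.  In particular the length is never 0. *)
Definition blen (z : int) : nat := (up_log 2 `|z|.+1).+1.

(** * Algorithms: random access machines under the logarithmic cost criterion

    The memory cells hold integers of arbitrary size.  They are addressed by
    integers and grouped into banks; a program names only finitely many banks,
    each by a literal, so this is the usual single-memory machine up to an
    interleaving of the addresses.  The instructions are those of the textbook
    machine (+, -, *, /, direct and indirect load and store), with structured
    control flow instead of jumps.

    Each evaluation step costs the binary length of the value it produces; as
    operands and addresses are themselves evaluated, their lengths are charged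
    too.  Hence polynomial time on this machine is polynomial time on a Turing
    machine. *)

Definition store : Type := nat -> int -> int.

Inductive binop := Add | Sub | Mul | Div.

Inductive expr :=
  | Const of int
  | Read of nat & expr
  | Op of binop & expr & expr.

Inductive prog :=
  | Skip
  | Write of nat & expr & expr (* bank, address, value *)
  | Seq of prog & prog
  | If of expr & prog & prog   (* the test is "the value is positive" *)
  | While of expr & prog.

Definition eval_op (o : binop) (x y : int) : int :=
  match o with
  | Add => x + y
  | Sub => x - y
  | Mul => x * y
  | Div => (x %/ y)%Z
  end.

Fixpoint eval (s : store) (e : expr) : int :=
  match e with
  | Const z => z
  | Read b e1 => s b (eval s e1)
  | Op o e1 e2 => eval_op o (eval s e1) (eval s e2)
  end.

Fixpoint cost (s : store) (e : expr) : nat :=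
  (match e with
   | Const _ => 0
   | Read _ e1 => cost s e1
   | Op _ e1 e2 => cost s e1 + cost s e2
   end + blen (eval s e))%N.

Definition update (s : store) (b : nat) (a z : int) : store :=
  fun b' a' => if (b' == b) && (a' == a) then z else s b' a'.

(** [exec p s t s']: started on memory [s], the program [p] halts after time
    [t] with memory [s']. *)
Inductive exec : prog -> store -> nat -> store -> Prop :=
  | ExecSkip s : exec Skip s 1 s
  | ExecWrite s b ea ez :
      exec (Write b ea ez) s (cost s ea + cost s ez)
           (update s b (eval s ea) (eval s ez))
  | ExecSeq p q s t s' t' s'' :
      exec p s t s' -> exec q s' t' s'' -> exec (Seq p q) s (t + t') s''
  | ExecIfTrue e p q s t s' :
      0 < eval s e -> exec p s t s' -> exec (If e p q) s (cost s e + t) s'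
  | ExecIfFalse e p q s t s' :
      eval s e <= 0 -> exec q s t s' -> exec (If e p q) s (cost s e + t) s'
  | ExecWhileTrue e p s t s' t' s'' :
      0 < eval s e -> exec p s t s' -> exec (While e p) s' t' s'' ->
      exec (While e p) s (cost s e + t + t') s''
  | ExecWhileFalse e p s :
      eval s e <= 0 -> exec (While e p) s (cost s e) s.

Lemma exec_det p s t1 s1 t2 s2 :
  exec p s t1 s1 -> exec p s t2 s2 -> t1 = t2 /\ s1 = s2.
Proof.
move=> H1; elim: H1 t2 s2 => {p s t1 s1} *;
  match goal with H : exec _ _ ?t ?s |- _ = ?t /\ _ = ?s => inversion H; subst end;
  repeat match goal with
  | IH : forall t s, exec ?p ?s0 t s -> _, H : exec ?p ?s0 _ _ |- _ =>
    case: (IH _ _ H) => *; subst; clear IH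
  | H : is_true (0 < ?x), H' : is_true (?x <= 0) |- _ =>
    by move: H; rewrite Order.TotalTheory.ltNge H'
  end; by [].
Qed.

(** The answer is read off cell 0 of bank 0. *)
Definition accepts (s : store) : Prop := s 0%N 0 = 1.

(** * Tables and line-sums

    All indices start at 0, and the distinguished last coordinate, of range
    [n], is [ord_max : 'I_d.+1]. *)

Section Tables.
Variables (d : nat) (m : d.-tuple nat) (n : nat).

Definition dim (j : 'I_d.+1) : nat := tnth (rcons_tuple m n) j.

Definition entry : finType := {dffun forall j : 'I_d.+1, 'I_(dim j)}.

(** Indices with coordinate [j] left out. *)
Definition line (j : 'I_d.+1) : finType :=
  {dffun forall l : 'I_d, 'I_(dim (lift j l))}.

Definition on_line (j : 'I_d.+1) (r : line j) (i : entry) : bool :=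
  [forall l : 'I_d, i (lift j l) == r l].

Definition line_sums : Type := forall j : 'I_d.+1, line j -> int.

Definition has_line_sums (v : line_sums) (x : entry -> nat) : Prop :=
  forall (j : 'I_d.+1) (r : line j),
    \sum_(i : entry | on_line r i) (x i)%:Z = v j r.

Definition entry_unique (v : line_sums) (k : entry) : Prop :=
  forall x y : entry -> nat,
    has_line_sums v x -> has_line_sums v y -> x k = y k.

Definition line_sums_length (v : line_sums) : nat :=
  (\sum_(j < d.+1) \sum_(r : line j) blen (v j r))%N.

(** Mixed radix number of a line, the first remaining coordinate varying
    fastest. *)
Definition line_rank (j : 'I_d.+1) (r : line j) : nat :=
  (\sum_(l < d) r l * \prod_(l' < d | l' < l) dim (lift j l'))%N.

(** Initial memory: bank 0 holds n, k_1, ..., k_{d+1} in cells 0, ..., d+1,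
    and bank j+1 holds the line-sums along coordinate [j], each at the address
    [line_rank] of its line.  All other cells hold 0. *)
Definition input (v : line_sums) (k : entry) : store := fun b a =>
  if b is b'.+1 then
    if insub b' is Some j then
      if [pick r : line j | (line_rank r)%:Z == a] is Some r then v j r else 0
    else 0
  else if a is Posz a' then
    nth 0 (n%:Z :: [seq (k j : nat)%:Z | j <- enum 'I_d.+1]) a'
  else 0.

End Tables.

Lemma mixed_radix_inj p (N a b : 'I_p -> nat) :
    (forall l, a l < N l)%N -> (forall l, b l < N l)%N ->
    (\sum_(l < p) a l * \prod_(l' < p | l' < l) N l' =
     \sum_(l < p) b l * \prod_(l' < p | l' < l) N l')%N ->
  a =1 b.
Proof.
elim: p N a b => [|p IH] N a b ha hb; first by move=> _ [].
have step (c : 'I_p.+1 -> nat) :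
    (\sum_(l < p.+1) c l * \prod_(l' < p.+1 | l' < l) N l' =
     (\sum_(l < p) c (lift ord0 l) *
        \prod_(l' < p | l' < l) N (lift ord0 l')) * N ord0 + c ord0)%N.
  rewrite big_ord_recl big_pred0 // muln1 addnC; congr addn.
  rewrite big_distrl; apply: eq_bigr => l _ /=.
  by rewrite big_mkcond big_ord_recl /= -big_mkcond /= mulnCA mulnC.
rewrite !step => E.
have N0 : (0 < N ord0)%N by apply: leq_trans (ha ord0).
have E0 : a ord0 = b ord0.
  by move/(congr1 (modn^~ (N ord0))): E; rewrite !modnMDl !modn_small.
move: E; rewrite E0 => /addIn/eqP; rewrite eqn_pmul2r // => /eqP E l.
case: (unliftP ord0 l) => [l' ->|->] //.
by apply: (IH (fun l => N (lift ord0 l)) (fun l => a (lift ord0 l))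
              (fun l => b (lift ord0 l))) => // ?.
Qed.

Lemma line_rank_inj d (m : d.-tuple nat) n (j : 'I_d.+1) :
  injective (@line_rank d m n j).
Proof.
move=> r r' E; apply/ffunP => l; apply: val_inj => /=.
by apply: (mixed_radix_inj (N := fun l => dim m n (lift j l))
  (a := fun l => nat_of_ord (r l)) (b := fun l => nat_of_ord (r' l))).
Qed.

(* Main.v *)
Require Import Defs.
From mathcomp Require Import all_boot all_order all_algebra.
From mathcomp Require Import zify.
From Stdlib Require Import Classical_Prop FunctionalExtensionality.

(** Why the entry uniqueness problem is polynomial for fixed [d] and [m].

    For an integer array [x] on the entries and a divisor [Q], let [obj Q x] be
    the sum of the negative parts of the entries of [x] plus the sum, over all
    entries [e] and all coordinates [j], of the distance between the line-sum of
    [x] along [j] through [e] and the prescribed one divided by [Q] and rounded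
    down.  The tables of the set S are exactly the zeros of [obj 1], and [obj Q]
    is a sum of convex functions, each of one entry or of one line-sum.

    Short moves.  There is a constant [B], independent of [n], such that every
    nonzero integer array [h] has a nonzero part [g] of l1-norm at most [B] all
    of whose entries and line-sums lie between 0 and those of [h]
    ([short_moves]).  Dickson's lemma is used twice: within one slice it
    yields finitely many building blocks, independent of [n]; across the slices,
    only the number of times that each block is used matters for the sums along
    the last coordinate, and these multiplicities form vectors of bounded
    dimension.  By convexity, an array that no move of norm at most [B] improves
    minimises [obj Q] ([local_opt_global]); and from a zero of [obj Q] at which
    the entry [k] is not determined, one such move leads to a zero with another
    value at [k] ([short_witness]).  There are only polynomially many moves of
    norm at most [B], so all of them can be tried.

    Scaling.  If [x] minimises [obj (2 * Q)], then [obj Q (2 * x)] exceeds the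
    minimum of [obj Q] by at most a polynomial in [n] ([gap_scale]).  As [obj]
    takes integer values, descent by short moves from [2 * x] ends after
    polynomially many rounds.  The search starts at the zero array, with a power
    of two larger than the absolute values of all line-sums as divisor, and
    halves the divisor down to 1 ([run_solve]).  The last round, which finds no
    improvement, has looked at all short moves, so it has also decided whether
    the entry [k] is unique; if S is empty no zero was ever met, and the entry
    is unique vacuously.

    Running time.  The program never multiplies two cells, so one step lengthens
    the contents of the memory by at most a constant number of bits, and the
    logarithmic cost is polynomial in the number of steps ([uexec_exec]).  It
    remains to count steps. *)

Set Implicit Arguments.
Unset Strict Implicit.
Unset Printing Implicit Defensive.
Import Order.TTheory GRing.Theory Num.Theory.
Local Open Scope ring_scope.

(** * Conformal parts of bounded size *)

Lemma uniform_bound (Q : nat -> nat -> Prop) :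
  (forall c B B', (B <= B')%N -> Q c B -> Q c B') ->
  (forall c, exists B, Q c B) ->
  forall N, exists B, forall c, (c < N)%N -> Q c B.
Proof.
move=> mono ex; elim=> [|N [B hB]]; first by exists 0%N.
have [B' hB'] := ex N; exists (maxn B B') => c.
rewrite ltnS leq_eqVlt => /orP[/eqP-> | /hB].
  by apply: mono hB'; apply: leq_maxr.
by apply: mono; apply: leq_maxl.
Qed.

(** Dickson's lemma in the form of a bound: below every element of [P] there is
    one of bounded size.  The size is an arbitrary function, which makes the
    induction on the coordinates go through: its maximum with the new coordinate
    leaves only finitely many values of that coordinate to treat, those that are
    too small to be dominated automatically. *)
Lemma dickson (V : Type) (T : eqType) (co : T -> V -> nat) (ts : seq T)
    (sz : V -> nat) (P : V -> Prop) :
  exists B, forall p, P p -> exists l,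
    [/\ P l, (sz l <= B)%N & forall t, t \in ts -> (co t l <= co t p)%N].
Proof.
elim: ts sz P => [|t ts IH] sz P.
  have [[p0 hp0]|none] := classic (exists p, P p); last first.
    by exists 0%N => p hp; case: none; exists p.
  by exists (sz p0) => p _; exists p0.
have [B0 h0] := IH (fun l => maxn (sz l) (co t l)) P.
have [c B B' leB h p hp e|c|B1 h1] := @uniform_bound (fun c B => forall p,
    P p -> co t p = c -> exists l, [/\ P l, (sz l <= B)%N &
      forall t', t' \in t :: ts -> (co t' l <= co t' p)%N]) _ _ B0.
- by have [l [? hl ?]] := h p hp e; exists l; split=> //; apply: leq_trans leB.
- have [B hB] := IH sz (fun l => P l /\ co t l = c); exists B => p hp e.
  have [l [[hl1 hl2] hl3 hl4]] := hB p (conj hp e).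
  exists l; split=> // t'; rewrite inE => /orP[/eqP->|]; last exact: hl4.
  by rewrite hl2 e.
exists (maxn B0 B1) => p hp; have [lt|ge] := ltnP (co t p) B0.
  have [l [? hl ?]] := h1 _ lt p hp erefl.
  by exists l; split=> //; apply: leq_trans (leq_maxr _ _).
have [l [hl1]] := h0 p hp; rewrite geq_max => /andP[hl2 hl3] hl4.
exists l; split=> //; first by apply: leq_trans (leq_maxl _ _).
move=> t'; rewrite inE => /orP[/eqP->|]; last exact: hl4.
exact: leq_trans ge.
Qed.

(** The conformal order, in which Graver bases are the sets of minimal elements. *)
Definition conf (x y : int) : bool := (0 <= x <= y) || (y <= x <= 0).

Lemma conf_trans y x z : conf x y -> conf y z -> conf x z.
Proof. rewrite /conf; lia. Qed.

Lemma conf0 y : conf 0 y.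
Proof. rewrite /conf; lia. Qed.

Lemma conf_sub x y : conf x y -> conf (y - x) y.
Proof. rewrite /conf; lia. Qed.

Lemma sum_mask_bounds (T : eqType) (F : T -> int) (s : seq T) (m : bitseq) :
  (forall t, t \in s -> 0 <= F t) ->
  0 <= \sum_(t <- mask m s) F t <= \sum_(t <- s) F t.
Proof.
elim: s m => [|t s IH] m h; first by rewrite mask0 big_nil.
have ht : 0 <= F t by apply: h; rewrite mem_head.
have hs u : u \in s -> 0 <= F u by move=> hu; apply: h; rewrite inE hu orbT.
case: m => [|[] m] /=; rewrite ?big_cons ?big_nil.
- by have /andP[h1 h2] := IH [::] hs; rewrite lexx addr_ge0 // (le_trans h1).
- by have /andP[h1 h2] := IH m hs; rewrite addr_ge0 // lerD2l.
- by have /andP[h1 h2] := IH m hs; rewrite h1 ler_wpDl.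
Qed.

(** Terms that all lie on the same side of 0 as their total cannot overshoot
    it in a partial sum. *)
Lemma conf_mask (T : eqType) (F : T -> int) (s : seq T) (m : bitseq) y :
  (forall t, t \in s -> conf (F t) y) -> \sum_(t <- s) F t = y ->
  conf (\sum_(t <- mask m s) F t) y.
Proof.
move=> h e; rewrite /conf; have [y0|y0] := lerP 0 y.
  suff: 0 <= \sum_(t <- mask m s) F t <= \sum_(t <- s) F t by rewrite e; lia.
  by apply: sum_mask_bounds => t /h; rewrite /conf; lia.
suff: 0 <= \sum_(t <- mask m s) - F t <= \sum_(t <- s) - F t.
  by rewrite !sumrN e oppr_ge0 lerN2 => /andP[-> ->]; rewrite orbT.
by apply: sum_mask_bounds => t /h; rewrite /conf; lia.
Qed.

(** Terms on one side of 0 cannot cancel. *)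
Lemma conf_sum_neq0 (T : eqType) (F : T -> int) (s : seq T) y t0 :
  (forall t, t \in s -> conf (F t) y) -> t0 \in s -> F t0 != 0 ->
  \sum_(t <- s) F t != 0.
Proof.
move=> h ht0 nz; have [y0|y0] := lerP 0 y.
  apply: contra nz; rewrite big_seq psumr_eq0 => [|t /h]; last by rewrite /conf; lia.
  by move=> /allP/(_ _ ht0)/implyP; apply.
apply: contra nz; rewrite -oppr_eq0 -sumrN big_seq psumr_eq0 => [|t /h].
  by move=> /allP/(_ _ ht0)/implyP/(_ ht0); rewrite oppr_eq0.
by rewrite /conf; lia.
Qed.

Lemma perm_mask_negb (T : eqType) (m : bitseq) (s : seq T) :
  size m = size s -> perm_eq (mask m s ++ mask (map negb m) s) s.
Proof.
elim: s m => [|t s IH] [|b m] //= [/IH h]; case: b => /=.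
  by rewrite perm_cons.
by rewrite perm_catC /= perm_cons perm_catC.
Qed.

Section Conformal.
Variables (K R : finType) (M : K -> R -> int).

Definition tot (s : seq K) (r : R) : int := \sum_(k <- s) M k r.

(** Dickson's lemma for the multiplicities of a list together with the positive
    and the negative parts of its totals: domination in these coordinates says
    both that the smaller list is contained in the larger one and that its
    totals are conformal. *)
Lemma conf_part (P : seq K -> Prop) :
  exists B, forall s, P s -> exists l,
    [/\ P l, (size l <= B)%N, forall k, (count_mem k l <= count_mem k s)%N
      & forall r, conf (tot l r) (tot s r)].
Proof.
pose co (t : K + (R + R)) (s : seq K) : nat := match t with
  | inl k => count_mem k s
  | inr (inl r) => if 0 <= tot s r then `|tot s r|%N else 0%N
  | inr (inr r) => if tot s r <= 0 then `|tot s r|%N else 0%N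
  end.
have [B hB] := dickson co (enum {: K + (R + R)}) size P.
exists B => s /hB[l [Pl sl hl]]; exists l.
have {}hl t : (co t l <= co t s)%N by apply: hl; rewrite mem_enum.
split=> // [k|r]; first exact: (hl (inl k)).
have := hl (inr (inl r)); have := hl (inr (inr r)); rewrite /= /conf.
move: (tot l r) (tot s r) => x y.
by case: (leP 0 x); case: (leP x 0); case: (leP 0 y); case: (leP y 0); lia.
Qed.

Lemma tot_cat s1 s2 r : tot (s1 ++ s2) r = tot s1 r + tot s2 r.
Proof. exact: big_cat. Qed.

(** Splitting off conformal parts until all totals vanish.  A remainder with
    zero totals is dropped, so that only the totals of the list are preserved. *)
Lemma conf_decomp : exists B, forall s, exists ss : seq (B.-bseq K),
  (forall r, \sum_(t <- ss) tot t r = tot s r) /\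
  (forall t, t \in ss -> (exists r, tot t r != 0) /\
     forall r, conf (tot t r) (tot s r)).
Proof.
have [B hB] := conf_part (fun s => exists r, tot s r != 0); exists B => s.
have [N] := ubnP (size s); elim: N s => // N IH s /ltnSE sN.
have [nz|z] := classic (exists r, tot s r != 0); last first.
  exists [::]; split=> // r; rewrite big_nil.
  by apply/esym/eqP/negP => h; case: z; exists r; apply/negP.
have [l [[r0 hr0] sl hc hl]] := hB s nz.
have [s1 s1s pl] : exists2 s1, subseq s1 s & perm_eq l s1.
  by apply/count_subseqP.
have [m sm es1] := subseqP s1s.
pose s2 := mask (map negb m) s.
have ps : perm_eq (l ++ s2) s.
  apply: perm_trans (perm_mask_negb sm).
  by rewrite -es1 perm_cat2r.
have tots r : tot s r = tot l r + tot s2 r.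
  by rewrite -tot_cat; apply/esym/perm_big.
have l0 : (0 < size l)%N.
  by case: (l) hr0 => //; rewrite /tot big_nil eqxx.
have [|ss [h1 h2]] := IH s2.
  rewrite -(ltn_add2l (size l)) -size_cat (perm_size ps) -ltnS in sN *.
  by rewrite (leq_trans sN) // -[N.+1]add1n leq_add2r.
exists (Bseq sl :: ss); split=> [r|t].
  by rewrite big_cons h1 tots.
rewrite inE => /orP[/eqP->|/h2[h3 h4]]; first by split=> //; exists r0.
split=> // r; apply: conf_trans (h4 r) _.
by have := conf_sub (hl r); rewrite tots addrC addKr.
Qed.

End Conformal.

(** * Short moves in arrays with many slices *)
Section ShortConformal.
Variables (I J : finType) (inc : J -> pred I).

(** [(a, b)] stands for the unit move at [a], upwards if [b] holds.  Its values
    are the changes of the entries and of the line-sums within a slice. *)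
Definition unit_val (k : I * bool) (r : I + J) : int :=
  (if k.2 then 1 else -1) *
  (match r with inl a => k.1 == a | inr c => inc c k.1 end)%:R.

Definition units (u : I -> int) : seq (I * bool) :=
  flatten [seq nseq `|u a|%N (a, 0 <= u a) | a <- enum I].

Lemma sum_flatten (T : Type) (F : T -> int) (ss : seq (seq T)) :
  \sum_(t <- flatten ss) F t = \sum_(s <- ss) \sum_(t <- s) F t.
Proof.
by elim: ss => [|s ss IH]; rewrite /= ?big_nil // big_cat big_cons IH.
Qed.

Lemma tot_units u r : tot unit_val (units u) r =
  \sum_a u a * (match r with inl a' => a == a' | inr c => inc c a end)%:R.
Proof.
rewrite /tot sum_flatten big_map big_enum /=; apply: eq_bigr => a _.
rewrite big_nseq iter_addr_0 /unit_val /= -mulrnAl; congr (_ * _).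
by case: (lerP 0 (u a)) => h; lia.
Qed.

Lemma tot_units_entry u a : tot unit_val (units u) (inl a) = u a.
Proof.
rewrite tot_units (bigD1 a) //= eqxx mulr1 big1 ?addr0 // => b /negPf->.
by rewrite mulr0.
Qed.

Lemma tot_units_line u c :
  tot unit_val (units u) (inr c) = \sum_(a | inc c a) u a.
Proof.
rewrite tot_units [RHS]big_mkcond /=; apply: eq_bigr => a _.
by case: ifP; rewrite ?mulr1 ?mulr0.
Qed.

Lemma tot_line t c : tot unit_val t (inr c) =
  \sum_(a | inc c a) tot unit_val t (inl a).
Proof.
rewrite /tot exchange_big; apply: eq_bigr => -[a b] _ /=.
rewrite /unit_val /= -big_distrr /=; congr (_ * _).
rewrite big_mkcond (bigD1 a) //= eqxx big1 ?addr0; first by case: ifP.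
by move=> a' /negPf; rewrite eq_sym => ->; rewrite if_same.
Qed.

Lemma norm_tot_entries t :
  (\sum_a `|tot unit_val t (inl a)| <= size t)%N.
Proof.
elim: t => [|[a b] t IH]; first by rewrite big1 // => a _; rewrite /tot big_nil.
have -> : size ((a, b) :: t) = (\sum_a' (a == a') + size t)%N.
  rewrite (bigD1 a) //= eqxx big1 ?addn0 //.
  by move=> a' /negPf; rewrite eq_sym => ->.
apply: leq_trans (leq_add (leqnn _) IH); rewrite -big_split /=.
apply: leq_sum => a' _; rewrite /tot big_cons /unit_val /=.
set z := (\sum_(_ <- _) _); case: (a == a'); case: b; lia.
Qed.

(** Each slice is written as a sum of conformal blocks, which come from a finite
    set that does not depend on [n].  In the list of all blocks of all slices,
    [conf_part] finds a bounded conformal part with respect to the sums across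
    the slices; the remaining sums are conformal for any choice of blocks. *)
Lemma short_conformal : exists B : nat, forall n (h : I -> 'I_n -> int),
  (exists a i, h a i != 0) -> exists g : I -> 'I_n -> int,
  [/\ exists a i, g a i != 0,
      (\sum_a \sum_i `|g a i| <= B)%N,
      forall a i, conf (g a i) (h a i),
      forall c i, conf (\sum_(a | inc c a) g a i) (\sum_(a | inc c a) h a i)
    & forall a, conf (\sum_i g a i) (\sum_i h a i)].
Proof.
have [B1 hB1] := conf_decomp unit_val.
pose M2 (t : B1.-bseq (I * bool)) a := tot unit_val t (inl a).
have [B2 hB2] := conf_part M2 (fun s => s != [::]).
exists (B2 * B1)%N => n h [a0 [i0 nz0]].
have /fin_all_exists[ss hss] i := hB1 (units (fun a => h a i)).
pose S := flatten [seq [seq (i, t) | t <- ss i] | i <- enum 'I_n].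
have memS p : p \in S -> p.2 \in ss p.1.
  by move=> /flatten_mapP[i _ /mapP[t ht ->]].
have sumS (F : 'I_n -> B1.-bseq (I * bool) -> int) :
    \sum_(p <- S) F p.1 p.2 = \sum_i \sum_(t <- ss i) F i t.
  rewrite sum_flatten big_map big_enum /=.
  by apply: eq_bigr => i _; rewrite big_map.
have sumSi i r : \sum_(p <- S) (if p.1 == i then tot unit_val p.2 r else 0) =
    tot unit_val (units (h^~ i)) r.
  rewrite (sumS (fun i' t => if i' == i then tot unit_val t r else 0)).
  rewrite (bigD1 i) //= eqxx [X in _ + X]big1 ?addr0; first by case: (hss i) => ->.
  by move=> i' /negPf->; rewrite big1.
have confS p i r : p \in S ->
    conf (if p.1 == i then tot unit_val p.2 r else 0)
         (tot unit_val (units (h^~ i)) r).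
  move=> /memS hp; case: eqP => [<-|_]; last exact: conf0.
  by case: (hss p.1) => _ /(_ _ hp)[].
have S0 : map snd S != [::].
  apply: contra nz0 => /eqP/(congr1 size); rewrite size_map => /size0nil e.
  by have := sumSi i0 (inl a0); rewrite e big_nil tot_units_entry => <-.
have [l [l0 sl hl cl]] := hB2 _ S0.
(* The part found is a list of blocks; the mask recovers their slices. *)
have [s1 /subseqP[m sm es1] pl] : exists2 s1, subseq s1 (map snd S) & perm_eq l s1.
  by apply/count_subseqP.
pose S' := mask m S.
have S's1 : map snd S' = s1 by rewrite es1 map_mask.
pose g a i : int := \sum_(p <- S') if p.1 == i then M2 p.2 a else 0.
have gline c i : \sum_(a | inc c a) g a i =
    \sum_(p <- S') if p.1 == i then tot unit_val p.2 (inr c) else 0.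
  rewrite exchange_big; apply: eq_bigr => p _ /=.
  by case: eqP => _; rewrite ?tot_line // big1.
have hline a : \sum_i h a i = tot M2 (map snd S) a.
  rewrite /tot big_map (sumS (fun _ t => M2 t a)); apply: eq_bigr => i _.
  by case: (hss i) => -> _; rewrite tot_units_entry.
have gcol a : \sum_i g a i = tot M2 l a.
  rewrite exchange_big /tot (perm_big _ pl) -S's1 big_map /=.
  apply: eq_bigr => p _; rewrite (bigD1 p.1) //= eqxx big1 ?addr0 //.
  by move=> i; rewrite eq_sym => /negPf->.
have confg a i : conf (g a i) (h a i).
  rewrite -[h a i](tot_units_entry (h^~ i)).
  by apply: conf_mask (sumSi i (inl a)) => p hp; apply: confS.
exists g; split=> //.
- have : size S' != 0%N.
    rewrite -(size_map snd) S's1 -(perm_size pl).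
    by apply: contra l0 => /eqP/size0nil->.
  case eS' : S' => [|p S''] // _.
  have pS' : p \in S' by rewrite eS' mem_head.
  have pS : p \in S by apply: mem_mask pS'.
  have [a nza] : exists a, M2 p.2 a != 0.
    case: (hss p.1) => _ /(_ _ (memS _ pS))[[[a|c] nz] _]; first by exists a.
    apply: NNPP => none; case/negP: nz; rewrite tot_line big1 // => a _.
    by apply/eqP/negP => /negP nz; apply: none; exists a.
  exists a, p.1; apply: (conf_sum_neq0 (y := h a p.1)) pS' _ => /=.
    move=> q /mem_mask qS; rewrite -[h a p.1](tot_units_entry (h^~ p.1)).
    exact: confS.
  by rewrite eqxx.
- rewrite exchange_big /=.
  have le1 i : (\sum_a `|g a i| <=
      \sum_(p <- S') if p.1 == i then \sum_a `|M2 p.2 a| else 0)%N.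
    rewrite (eq_bigr (fun p => \sum_a if p.1 == i then `|M2 p.2 a|%N else 0%N)); last first.
      by move=> p _; case: ifP => // _; rewrite big1.
    rewrite exchange_big; apply: leq_sum => a _; rewrite /g.
    elim: (S') => [|p s IH]; rewrite ?big_nil // !big_cons.
    apply: leq_trans (leq_add (leqnn _) IH).
    by case: eqP => _; move: (M2 p.2 a) (\sum_(_ <- s) _) => x z; lia.
  apply: (@leq_trans (\sum_i \sum_(p <- S') if p.1 == i then
    \sum_a `|M2 p.2 a| else 0)%N); first by apply: leq_sum => i _; apply: le1.
  rewrite exchange_big /=.
  apply: (@leq_trans (\sum_(p <- S') B1)%N); last first.
    rewrite big_const_seq iter_addn_0 count_predT mulnC leq_mul2r.
    by rewrite -(size_map snd) S's1 -(perm_size pl) sl orbT.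
  apply: leq_sum => p _; rewrite (bigD1 p.1) //= eqxx [X in (_ + X)%N]big1 ?addn0 => [|i]; last first.
    by rewrite eq_sym => /negPf->.
  by apply: leq_trans (norm_tot_entries _) (size_bseq _).
- move=> c i; rewrite gline -(tot_units_line (h^~ i)).
  by apply: conf_mask (sumSi i (inr c)) => p hp; apply: confS.
- by move=> a; rewrite gcol hline.
Qed.

End ShortConformal.

(** * The penalty function, its local minima and its scaling *)
Section Objective.
Variables (E C : finType) (inc : C -> pred E) (v : C -> int).
Implicit Types (x y g h : {ffun E -> int}) (Q : int).

Definition neg_part (z : int) : int := if z < 0 then - z else 0.

Definition along (c : C) x : int := \sum_(e | inc c e) x e.

(** The prescribed sums are divided by [Q]; for [Q = 1] the zeros are the
    nonnegative arrays with the prescribed sums. *)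
Definition obj Q x : int :=
  \sum_e neg_part (x e) + \sum_c `|(v c %/ Q)%Z - along c x|.

Definition norm1 h : nat := (\sum_e `|h e|)%N.

Definition conformal g h : Prop :=
  (forall e, conf (g e) (h e)) /\ (forall c, conf (along c g) (along c h)).

Lemma alongD c x y : along c (x + y) = along c x + along c y.
Proof. by rewrite -big_split; apply: eq_bigr => e _; rewrite ffunE. Qed.

Lemma obj_ge0 Q x : 0 <= obj Q x.
Proof.
apply: addr_ge0; apply: sumr_ge0 => // e _.
by rewrite /neg_part; case: ltP => //; lia.
Qed.

(** Supermodularity of convex functions on conformal steps: moving by [g] costs
    at least as much after the step [h] in the same direction as before it. *)
Lemma obj_convex Q x g h : conformal g (g + h) ->
  obj Q (x + g) + obj Q (x + h) <= obj Q x + obj Q (x + (g + h)).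
Proof.
move=> [ce cc]; rewrite /obj addrACA [leRHS]addrACA -!big_split /=.
apply: lerD; [apply: ler_sum => e _ | apply: ler_sum => c _].
  move: (ce e); rewrite /neg_part /conf !ffunE.
  move: (x e) (g e) (h e) => a b c.
  by case: (ltP (a + b)); case: (ltP (a + c)); case: (ltP a); case: (ltP (a + (b + c))); lia.
move: (cc c); rewrite /conf !alongD.
by move: (v c %/ Q)%Z (along c x) (along c g) (along c h) => a b d e; lia.
Qed.

Variable B : nat.
Hypothesis short : forall h, h != 0 ->
  exists g, [/\ g != 0, (norm1 g <= B)%N & conformal g h].

Lemma norm1_conformal g h : g != 0 -> conformal g (g + h) ->
  (norm1 h < norm1 (g + h)%R)%N.
Proof.
move=> nz [ce _]; have -> : norm1 (g + h) = (norm1 g + norm1 h)%N.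
  rewrite -big_split; apply: eq_bigr => e _; move: (ce e); rewrite ffunE /conf.
  by move: (g e) (h e) => a b /=; lia.
rewrite -[X in (X < _)%N]add0n ltn_add2r lt0n sum_nat_eq0.
apply: contra nz => /forallP z; apply/eqP/ffunP => e; rewrite ffunE.
by apply/eqP; rewrite -absz_eq0; apply: (implyP (z e)).
Qed.

(** Every array is reached from 0 by adding short conformal parts. *)
Lemma conformal_ind (P : {ffun E -> int} -> Prop) :
  P 0 ->
  (forall g h, (norm1 g <= B)%N -> conformal g (g + h) -> P h -> P (g + h)) ->
  forall h, P h.
Proof.
move=> P0 step h; have [N] := ubnP (norm1 h); elim: N h => // N IH h /ltnSE hN.
have [->//|nz] := eqVneq h 0; have [g [gnz gB cg]] := short nz.
move: cg hN; rewrite -{1 2 3}[h](subrK g) addrC => cg hN.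
apply: step => //; apply: IH.
by apply: leq_trans hN; apply: norm1_conformal.
Qed.

(** The short part [g] of a move [g + h] does not improve [x], hence by convexity
    it does not improve [x + h] either, and [h] is a smaller move. *)
Lemma local_opt_global Q x :
  (forall g, (norm1 g <= B)%N -> obj Q x <= obj Q (x + g)) ->
  forall y, obj Q x <= obj Q y.
Proof.
move=> loc y; rewrite -[y](subrK x) addrC; move: (y - x).
apply: conformal_ind => [|g h gB cgh IH]; first by rewrite addr0.
rewrite -(lerD2l (obj Q x)); apply: le_trans (obj_convex Q x cgh).
by apply: lerD => //; apply: loc.
Qed.

(** By convexity every conformal part of the difference of two zeros leads from
    [x] to another zero, and some part changes the entry [k]. *)
Lemma short_witness Q x y k : obj Q x = 0 -> obj Q y = 0 -> x k <> y k ->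
  exists g, [/\ (norm1 g <= B)%N, obj Q (x + g) = 0 & (x + g) k <> x k].
Proof.
move=> x0; rewrite -[y](subrK x) addrC; move: (y - x) => h.
elim/conformal_ind: h => [|g h gB cgh IH]; first by rewrite addr0.
have := obj_convex Q x cgh; rewrite x0.
have := obj_ge0 Q (x + g); have := obj_ge0 Q (x + h) => h1 h2 h3 h4.
have /eqP : obj Q (x + g) + obj Q (x + h) = 0.
  by apply/eqP; rewrite eq_le addr_ge0 // (le_trans h3) // h4.
rewrite paddr_eq0 // => /andP[/eqP e1 /eqP e2].
have [gk|gk] := eqVneq (g k) 0; last first.
  by exists g; split=> //; rewrite ffunE -[RHS]addr0 => /addrI/eqP; apply/negP.
by move=> ne; apply: IH => //; move: ne; rewrite !ffunE gk add0r.
Qed.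

(** Doubling costs at most 1 per sum, and halving an array, rounding down,
    costs 1 per entry and at most 1 plus the number of entries per sum. *)
Definition gap : nat := (#|E| + #|C| * (2 + #|E|))%N.

Lemma obj_double Q x : 0 < Q -> obj Q (x + x) <= 2 * obj (Q + Q) x + #|C|%:Z.
Proof.
move=> Q0; rewrite /obj mulrDr -addrA; apply: lerD.
  rewrite big_distrr /=; apply: ler_sum => e _; rewrite ffunE /neg_part.
  by move: (x e) => a; case: (ltP (a + a)); case: (ltP a); lia.
rewrite -sum1_card (big_morph _ PoszD (erefl _)) big_distrr -big_split /=.
apply: ler_sum => c _; rewrite alongD.
have : 2 * (v c %/ (Q + Q))%Z <= (v c %/ Q)%Z <= 2 * (v c %/ (Q + Q))%Z + 1 by nia.
by move: (v c %/ Q)%Z (v c %/ _)%Z (along c x) => a b z; lia.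
Qed.

Lemma obj_half Q y : 0 < Q ->
  2 * obj (Q + Q) [ffun e => (y e %/ 2)%Z]
    <= obj Q y + (#|E| + #|C| * (1 + #|E|))%N%:Z.
Proof.
move=> Q0; rewrite /obj mulrDr PoszD addrACA; apply: lerD.
  rewrite -sum1_card (big_morph _ PoszD (erefl _)) big_distrr -big_split /=.
  apply: ler_sum => e _; rewrite ffunE /neg_part.
  by move: (y e) => a; case: (ltP (a %/ 2)%Z); case: (ltP a); lia.
rewrite -sum_nat_const (big_morph _ PoszD (erefl _)) big_distrr -big_split /=.
apply: ler_sum => c _; set y' := finfun _.
have : 2 * (v c %/ (Q + Q))%Z <= (v c %/ Q)%Z <= 2 * (v c %/ (Q + Q))%Z + 1 by nia.
have : 2 * along c y' <= along c y <= 2 * along c y' + #|E|%:Z.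
  rewrite /along big_distrr /=; apply/andP; split.
    by apply: ler_sum => e _; rewrite ffunE; lia.
  rewrite -sum1_card (big_morph _ PoszD (erefl _)).
  apply: (@le_trans _ _ (\sum_(e | inc c e) (2 * y' e + 1))).
    by apply: ler_sum => e _; rewrite ffunE; lia.
  rewrite big_split /= lerD2l big_mkcond /=.
  by apply: ler_sum => e _; case: ifP.
by move: (v c %/ Q)%Z (v c %/ _)%Z (along c y) (along c y') #|E| => a b z z' n; lia.
Qed.

Lemma gap_scale Q x : 0 < Q ->
  (forall y, obj (Q + Q) x <= obj (Q + Q) y) ->
  forall y, obj Q (x + x) <= obj Q y + gap%:Z.
Proof.
move=> Q0 opt y; have := obj_double x Q0; have := obj_half y Q0.
by have := opt [ffun e => (y e %/ 2)%Z]; rewrite /gap; lia.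
Qed.

Lemma gap_top Q : (forall c, `|v c| < Q) ->
  forall y, obj Q (0 + 0) <= obj Q y + gap%:Z.
Proof.
move=> big y; apply: le_trans (_ : #|C|%:Z <= _); last first.
  by have := obj_ge0 Q y; rewrite /gap; lia.
rewrite addr0 /obj big1 ?add0r => [|e _]; last by rewrite ffunE.
rewrite -sum1_card (big_morph _ PoszD (erefl _)); apply: ler_sum => c _.
rewrite /along big1 => [|e _]; last by rewrite ffunE.
by have := big c; nia.
Qed.

Lemma sum_le_obj0 c : `|v c| <= obj 1 0.
Proof.
rewrite /obj [in leRHS](bigD1 c) //= divz1.
have -> : along c 0 = 0 by rewrite /along big1 // => e _; rewrite ffunE.
rewrite subr0 addrCA lerDl addr_ge0 // sumr_ge0 // => e _.
by rewrite /neg_part ffunE.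
Qed.

Lemma obj_eq0 x : obj 1 x = 0 <->
  (forall e, 0 <= x e) /\ (forall c, along c x = v c).
Proof.
have ge1 e : 0 <= neg_part (x e) by rewrite /neg_part; case: ltP => //; lia.
rewrite /obj; split=> [/eqP|[h1 h2]].
  rewrite paddr_eq0 ?sumr_ge0 // !psumr_eq0 // => /andP[/allP z1 /allP z2].
  split=> [e|c].
    by have := z1 e (mem_index_enum _); rewrite /neg_part; case: ltP => //; lia.
  by have := z2 c (mem_index_enum _); rewrite divz1; lia.
rewrite !big1 // => [c _|e _]; first by rewrite divz1 h2 subrr.
by rewrite /neg_part ltNge h1.
Qed.

End Objective.

(** * Counting steps instead of bits *)
(** Bounds both the number of nodes of [e] and the number of bits by which the
    value of a multiplication-free [e] can exceed the contents of the memory. *)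
Fixpoint esize (e : expr) : nat :=
  match e with
  | Const z => blen z
  | Read _ e1 => (esize e1).+1
  | Op _ e1 e2 => (esize e1 + esize e2).+1
  end.

Fixpoint mulfree (e : expr) : bool :=
  match e with
  | Const _ => true
  | Read _ e1 => mulfree e1
  | Op o e1 e2 => [&& (if o is Mul then false else true), mulfree e1 & mulfree e2]
  end.

Fixpoint psize (p : prog) : nat :=
  match p with
  | Skip => 1
  | Write _ e1 e2 => esize e1 + esize e2
  | Seq p q => psize p + psize q
  | If e p q => esize e + psize p + psize q
  | While e p => esize e + psize p
  end.

Fixpoint pmulfree (p : prog) : bool :=
  match p with
  | Skip => true
  | Write _ e1 e2 => mulfree e1 && mulfree e2
  | Seq p q => pmulfree p && pmulfree q
  | If e p q => [&& mulfree e, pmulfree p & pmulfree q]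
  | While e p => mulfree e && pmulfree p
  end.

(** Execution with unit costs. *)
Inductive uexec : prog -> store -> nat -> store -> Prop :=
  | UExecSkip s : uexec Skip s 1 s
  | UExecWrite s b ea ez :
      uexec (Write b ea ez) s 1 (update s b (eval s ea) (eval s ez))
  | UExecSeq p q s t s' t' s'' :
      uexec p s t s' -> uexec q s' t' s'' -> uexec (Seq p q) s (t + t') s''
  | UExecIfTrue e p q s t s' :
      0 < eval s e -> uexec p s t s' -> uexec (If e p q) s t.+1 s'
  | UExecIfFalse e p q s t s' :
      eval s e <= 0 -> uexec q s t s' -> uexec (If e p q) s t.+1 s'
  | UExecWhileTrue e p s t s' t' s'' :
      0 < eval s e -> uexec p s t s' -> uexec (While e p) s' t' s'' ->
      uexec (While e p) s (t + t').+1 s''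
  | UExecWhileFalse e p s :
      eval s e <= 0 -> uexec (While e p) s 1 s.

Definition bits (s : store) (L : nat) := forall b a, (blen (s b a) <= L)%N.

Lemma blen_le z L : (blen z <= L.+1)%N = (`|z|.+1 <= 2 ^ L)%N.
Proof.
rewrite /blen ltnS; apply/idP/idP => h; last exact: up_log_min.
by apply: leq_trans (up_logP _ _) (leq_pexp2l _ h).
Qed.

Lemma blen_op o x y L : (if o is Mul then false else true) ->
  (blen x <= L)%N -> (blen y <= L)%N -> (blen (eval_op o x y) <= L.+1)%N.
Proof.
case: L => [|L]; first by rewrite /blen.
rewrite !blen_le expnS => om hx hy; set z := eval_op _ _ _.
suff : (`|z| <= `|x| + `|y|)%N by lia.
rewrite {}/z; case: o om => // _ /=; try lia.
have [->|y0] := eqVneq y 0; first by rewrite divz0; lia.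
suff : (`|(x %/ y)%Z| <= `|x|)%N by lia.
by nia.
Qed.

Lemma esize_gt0 e : (0 < esize e)%N.
Proof. by case: e. Qed.

Lemma eval_blen s L e : bits s L -> mulfree e ->
  (blen (eval s e) <= L + esize e)%N.
Proof.
move=> hs; elim: e => [z|b e _|o e1 IH1 e2 IH2] /=.
- by rewrite leq_addl.
- by move=> _; apply: leq_trans (hs _ _) _; apply: leq_addr.
case/and3P=> om /IH1 h1 /IH2 h2; rewrite addnS; apply: blen_op => //.
  by apply: leq_trans h1 _; rewrite leq_add2l leq_addr.
by apply: leq_trans h2 _; rewrite leq_add2l leq_addl.
Qed.

Lemma cost_bound s L e : bits s L -> mulfree e ->
  (cost s e <= esize e * (L + esize e))%N.
Proof.
move=> hs; elim: e => [z|b e IH|o e1 IH1 e2 IH2] he.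
- have := eval_blen hs he; have := esize_gt0 (Const z); rewrite /= add0n; nia.
- have := eval_blen hs he; move: (IH he) => /=; set c := cost _ _.
  by set w := blen _; move: (esize e) => k; nia.
have := eval_blen hs he; move: he => /= /and3P[_ /IH1 h1 /IH2 h2].
move: h1 h2; set c1 := cost _ _; set c2 := cost _ _; set w := blen _.
by move: (esize e1) (esize e2) => k1 k2; nia.
Qed.

Lemma bits_update s L b a z : bits s L -> (blen z <= L)%N ->
  bits (update s b a z) L.
Proof. by move=> hs hz b' a'; rewrite /update; case: ifP. Qed.

Lemma bits_le s L L' : bits s L -> (L <= L')%N -> bits s L'.
Proof. by move=> hs le b a; apply: leq_trans le. Qed.

(** Without multiplications each step adds at most [K] bits to the longest cell,
    so after [u] steps all values met had at most [L + K * u] bits. *)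
Lemma uexec_exec K p s u s' : uexec p s u s' ->
  forall L, pmulfree p -> (psize p <= K)%N -> bits s L ->
  bits s' (L + K * u)%N /\
  exists t, exec p s t s' /\ (t <= u * (K * (L + K * u)))%N.
Proof.
have grow (u1 u2 T : nat) L : (u1 <= u2)%N -> (T <= u1 * (K * (L + K * u1)))%N ->
    (T <= u1 * (K * (L + K * u2)))%N.
  move=> le /leq_trans; apply; rewrite leq_mul2l leq_mul2l leq_add2l leq_mul2l le.
  by rewrite !orbT.
have costK e s0 L u0 : bits s0 L -> mulfree e -> (esize e <= K)%N ->
    (cost s0 e <= K * (L + K * u0.+1))%N.
  move=> hs he hK; apply: leq_trans (cost_bound hs he) _; apply: leq_mul => //.
  by rewrite leq_add2l (leq_trans hK) // mulnS leq_addr.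
elim=> {p s u s'}.
- move=> s L _ hK hs; split; first by apply: bits_le hs _; apply: leq_addr.
  exists 1%N; split; first by constructor.
  by move: hK => /= hK; nia.
- move=> s b ea ez L /= /andP[ha hz] hK hs; split.
    apply: bits_update; first by apply: bits_le hs _; apply: leq_addr.
    by apply: leq_trans (eval_blen hs hz) _; rewrite muln1 leq_add2l; lia.
  eexists; split; first by constructor.
  have := cost_bound hs ha; have := cost_bound hs hz.
  by move: (esize ea) (esize ez) hK => ka kz hK; nia.
- move=> p q s t s' t' s'' _ IH1 _ IH2 L /= /andP[hp hq] hK hs.
  have [|hs' [t1 [x1 b1]]] := IH1 L hp _ hs; first by lia.
  have [|hs'' [t2 [x2 b2]]] := IH2 _ hq _ hs'; first by lia.
  split; first by rewrite mulnDr addnA.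
  exists (t1 + t2)%N; split; first by econstructor; eauto.
  have g1 := grow _ (t + t')%N _ _ (leq_addr _ _) b1.
  by rewrite -addnA -mulnDr in b2; rewrite mulnDl leq_add.
- move=> e p q s t s' he _ IH L /= /and3P[h1 h2 h3] hK hs.
  have [|hs' [t1 [x1 b1]]] := IH L h2 _ hs; first by lia.
  split; first by apply: bits_le hs' _; rewrite leq_add2l leq_mul2l leqnSn orbT.
  exists (cost s e + t1)%N; split; first by apply: ExecIfTrue.
  have g1 := grow _ t.+1 _ _ (leqnSn _) b1.
  have c1 := costK e s L t hs h1.
  by rewrite mulSn leq_add // c1 //; lia.
- move=> e p q s t s' he _ IH L /= /and3P[h1 h2 h3] hK hs.
  have [|hs' [t1 [x1 b1]]] := IH L h3 _ hs; first by lia.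
  split; first by apply: bits_le hs' _; rewrite leq_add2l leq_mul2l leqnSn orbT.
  exists (cost s e + t1)%N; split; first by apply: ExecIfFalse.
  have g1 := grow _ t.+1 _ _ (leqnSn _) b1.
  have c1 := costK e s L t hs h1.
  by rewrite mulSn leq_add // c1 //; lia.
- move=> e p s t s' t' s'' he _ IH1 _ IH2 L /= hm hK hs.
  have /andP[h1 h2] := hm.
  have [|hs' [t1 [x1 b1]]] := IH1 L h2 _ hs; first by lia.
  have [|hs'' [t2 [x2 b2]]] := IH2 _ hm _ hs'; first by [].
  rewrite -addnA -mulnDr in b2 hs''.
  split; first by apply: bits_le hs'' _; rewrite leq_add2l leq_mul2l leqnSn orbT.
  exists (cost s e + t1 + t2)%N; split; first by apply: ExecWhileTrue x1 x2.
  have g1 := grow _ (t + t').+1 _ _ (leq_trans (leq_addr _ _) (leqnSn _)) b1.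
  have c1 := costK e s L (t + t')%N hs h1.
  rewrite mulSn mulnDl -addnA leq_add //; first by rewrite c1 //; lia.
  rewrite leq_add // (leq_trans b2) // leq_mul2l leq_mul2l leq_add2l leq_mul2l.
  by rewrite leqnSn !orbT.
- move=> e p s he L /= /andP[h1 h2] hK hs.
  split; first by apply: bits_le hs _; apply: leq_addr.
  exists (cost s e); split; first by apply: ExecWhileFalse.
  by rewrite mul1n; apply: costK => //; lia.
Qed.

(** * Program logic for the work memory *)
(** Work banks: the array under test, the best array found so far, the scalar
    variables, and the loop counters of the nested search, one for each depth. *)
Notation trial := 0%N (only parsing).
Notation held := 1%N (only parsing).
Notation vars := 2%N (only parsing).
Notation ctrs := 3%N (only parsing).

(** Scalar variables: the value of the penalty last computed; the value at the
    array held; whether the current round has improved it; whether two zeros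
    that differ at the target entry were seen; the divisor; the quantity that
    the initial divisor must exceed; the current slice; the current position on
    a line; the sum along that line; the cell being copied. *)
Notation vAcc := 0%N (only parsing).
Notation vBest := 1%N (only parsing).
Notation vGo := 2%N (only parsing).
Notation vFlag := 3%N (only parsing).
Notation vDiv := 4%N (only parsing).
Notation vTop := 5%N (only parsing).
Notation vSlice := 6%N (only parsing).
Notation vPos := 7%N (only parsing).
Notation vSum := 8%N (only parsing).
Notation vCell := 9%N (only parsing).

(** The contents of the banks that the program writes, at nonnegative addresses;
    everything below them is input and stays fixed. *)
Definition wstate : Type := nat -> nat -> int.

Definition upd (st : wstate) (c a : nat) (z : int) : wstate :=
  fun c' a' => if (c' == c) && (a' == a) then z else st c' a'.

Lemma upd_same st c a z : upd st c a z c a = z.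
Proof. by rewrite /upd !eqxx. Qed.

Lemma upd_other st c a z c' a' : (c', a') != (c, a) ->
  upd st c a z c' a' = st c' a'.
Proof. by rewrite /upd xpair_eqE; case: ifP. Qed.

Section Run.
Variables (inp : store) (b0 : nat).

Definition memory (st : wstate) : store := fun b a =>
  if (b < b0)%N then inp b a
  else if a is Posz q then st (b - b0)%N q else 0.

Definition rd (c : nat) (e : expr) : expr := Read (b0 + c) e.
Definition wr (c : nat) (ea ez : expr) : prog := Write (b0 + c) ea ez.
Definition cell (c a : nat) : expr := rd c (Const a).

Definition ev st e := eval (memory st) e.

Lemma ev_const st z : ev st (Const z) = z.
Proof. by []. Qed.

Lemma ev_op st o e1 e2 : ev st (Op o e1 e2) = eval_op o (ev st e1) (ev st e2).
Proof. by []. Qed.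

Lemma ev_rd st c e q : ev st e = Posz q -> ev st (rd c e) = st c q.
Proof. by rewrite /ev /= => ->; rewrite /memory ltnNge leq_addr /= addKn. Qed.

Lemma ev_cell st c a : ev st (cell c a) = st c a.
Proof. exact: ev_rd. Qed.

Lemma update_memory st c q z :
  update (memory st) (b0 + c) (Posz q) z = memory (upd st c q z).
Proof.
apply: functional_extensionality => b; apply: functional_extensionality => a.
rewrite /update /memory /upd; case: ltnP => hb.
  by case: eqP => // e; move: hb; rewrite e ltnNge leq_addr.
rewrite -{1}(subnKC hb) eqn_add2l; case: a => [q'|q'] //=.
by rewrite andbF.
Qed.

(** Total correctness with a bound on the number of steps. *)
Definition run (p : prog) (st : wstate) (U : nat) (R : wstate -> Prop) : Prop :=
  exists u st', [/\ uexec p (memory st) u (memory st'), (u <= U)%N & R st'].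

Lemma run_weak p st U R U' (R' : wstate -> Prop) :
  run p st U R -> (U <= U')%N -> (forall st', R st' -> R' st') ->
  run p st U' R'.
Proof.
by move=> [u [st' [x le r]]] leU h; exists u, st'; split; [|exact: leq_trans leU|exact: h].
Qed.

Lemma run_post p st U R (R' : wstate -> Prop) :
  run p st U R -> (forall st', R st' -> R' st') -> run p st U R'.
Proof. by move=> h hR; apply: run_weak h (leqnn _) hR. Qed.

Lemma run_skip U st (R : wstate -> Prop) : R st -> run Skip st U.+1 R.
Proof. by move=> r; exists 1%N, st; split=> //; constructor. Qed.

Lemma run_wr c ea ez q st (R : wstate -> Prop) : ev st ea = Posz q ->
  R (upd st c q (ev st ez)) -> run (wr c ea ez) st 1 R.
Proof.
move=> ha r; exists 1%N, (upd st c q (ev st ez)); split=> //.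
by rewrite -update_memory -ha; constructor.
Qed.

Lemma run_set c a ez st (R : wstate -> Prop) :
  R (upd st c a (ev st ez)) -> run (wr c (Const a) ez) st 1 R.
Proof. exact: run_wr. Qed.

Lemma run_seq p q st U1 U2 R1 R : run p st U1 R1 ->
  (forall st', R1 st' -> run q st' U2 R) -> run (Seq p q) st (U1 + U2) R.
Proof.
move=> [u1 [st1 [x1 l1 r1]]] h2; have [u2 [st2 [x2 l2 r2]]] := h2 _ r1.
exists (u1 + u2)%N, st2; split=> //; last exact: leq_add.
by apply: UExecSeq x1 x2.
Qed.

Lemma run_if e p q st U R :
  (0 < ev st e -> run p st U R) -> (ev st e <= 0 -> run q st U R) ->
  run (If e p q) st U.+1 R.
Proof.
move=> hp hq; case: (leP (ev st e) 0) => he.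
  have [u [st' [x l r]]] := hq he; exists u.+1, st'; split=> //.
  exact: UExecIfFalse.
have [u [st' [x l r]]] := hp he; exists u.+1, st'; split=> //.
exact: UExecIfTrue.
Qed.

Lemma run_while e p U (I : nat -> wstate -> Prop) (R : wstate -> Prop) :
  (forall k st, I k st -> ev st e <= 0 -> R st) ->
  (forall k st, I k st -> 0 < ev st e ->
     run p st U (fun st' => exists2 k', (k' < k)%N & I k' st')) ->
  forall k st, I k st -> run (While e p) st (1 + k * U.+1) R.
Proof.
move=> h0 hstep; elim/ltn_ind => k IH st hI; case: (leP (ev st e) 0) => he.
  by exists 1%N, st; split=> //; [exact: UExecWhileFalse|exact: (h0 _ _ hI he)].
have [u1 [st1 [x1 l1 [k' lt hI']]]] := hstep _ _ hI he.
have [u2 [st2 [x2 l2 r]]] := IH _ lt _ hI'.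
exists (u1 + u2).+1, st2; split=> //; first exact: UExecWhileTrue x1 x2.
have : (k'.+1 * U.+1 <= k * U.+1)%N by rewrite leq_mul2r lt orbT.
by rewrite mulSn; lia.
Qed.

Definition for_ (c a : nat) (n : expr) (body : prog) : prog :=
  Seq (wr c (Const a) (Const 0))
    (While (Op Defs.Sub n (cell c a))
      (Seq body (wr c (Const a) (Op Add (cell c a) (Const 1))))).

Lemma run_for c a ne body n U (I : nat -> wstate -> Prop) st (R : wstate -> Prop) :
  (forall i st', I i st' -> ev st' ne = Posz n) ->
  I 0%N (upd st c a 0) ->
  (forall i st', (i < n)%N -> I i st' -> st' c a = Posz i ->
     run body st' U (fun st2 => st2 c a = Posz i /\ I i.+1 (upd st2 c a i.+1))) ->
  (forall st', I n st' -> R st') ->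
  run (for_ c a ne body) st (2 + n * U.+2) R.
Proof.
move=> hn h0 hs hR; apply: (@run_weak _ _ (1 + (1 + n * U.+2)) R) => //.
apply: run_seq; first by apply: (run_set (R := fun st' => st' = upd st c a 0)).
move=> _ ->; pose I' k st' := exists i, [/\ (i + k = n)%N, I i st' & st' c a = Posz i].
apply: (run_while (I := I')); last by exists 0%N; rewrite upd_same; split.
- move=> k st' [i [e hI hi]]; rewrite ev_op ev_cell (hn _ _ hI) hi /= => le.
  by apply: hR; have <- : i = n by lia.
move=> k st' [i [e hI hi]]; rewrite ev_op ev_cell (hn _ _ hI) hi /= => lt.
have {}lt : (i < n)%N by lia.
rewrite -addn1; apply: run_seq; first exact: (hs i st' lt hI hi).
move=> st2 [hi2 hI2]; apply: run_set; rewrite ev_op ev_cell hi2 /=.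
exists k.-1; first lia.
exists i.+1; rewrite -[Posz i + 1]/(Posz (i + 1)) addn1 upd_same; split=> //; lia.
Qed.

(** [D] tells which cells may change. *)
Definition frame (D : nat -> nat -> bool) (st st' : wstate) :=
  forall c a, ~~ D c a -> st' c a = st c a.

Lemma frame_upd (D : nat -> nat -> bool) st st' c a z : D c a -> frame D st st' ->
  frame D st (upd st' c a z).
Proof.
move=> h f c' a' nd; rewrite upd_other ?f //.
by apply: contraNneq nd => -[-> ->].
Qed.

Lemma frame_trans (D1 D2 D : nat -> nat -> bool) st1 st2 st3 :
  (forall c a, D1 c a -> D c a) -> (forall c a, D2 c a -> D c a) ->
  frame D1 st1 st2 -> frame D2 st2 st3 -> frame D st1 st3.
Proof.
move=> h1 h2 f1 f2 c a nd; rewrite f2 ?f1 //.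
  by apply: contra nd; apply: h1.
by apply: contra nd; apply: h2.
Qed.

Lemma frame_le (D1 D : nat -> nat -> bool) st1 st2 :
  (forall c a, D1 c a -> D c a) -> frame D1 st1 st2 -> frame D st1 st2.
Proof. by move=> h f c a nd; apply: f; apply: contra nd; apply: h. Qed.

End Run.

(** * Local search and scaling as a program *)
Section SearchProgram.
Variables (b0 : nat) (size_e target_e : expr) (eval_obj : prog).

Definition var a : expr := cell b0 vars a.
Definition set a e : prog := wr b0 vars (Const (Posz a)) e.

Definition fill c e : prog := for_ b0 vars vCell size_e (wr b0 c (var vCell) e).

(** After a replacement the array held and the trial array coincide, so only a
    second zero can raise the flag. *)
Definition probe : prog :=
  Seq eval_obj
  (Seq (If (Op Defs.Sub (var vBest) (var vAcc))
          (Seq (set vBest (var vAcc)) (Seq (set vGo (Const 1))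
             (fill held (rd b0 trial (var vCell)))))
          Skip)
       (If (var vAcc) Skip
          (Seq (If (Op Defs.Sub (rd b0 trial target_e) (rd b0 held target_e))
                  (set vFlag (Const 1)) Skip)
               (If (Op Defs.Sub (rd b0 held target_e) (rd b0 trial target_e))
                  (set vFlag (Const 1)) Skip)))).

Definition nudge g z : prog :=
  wr b0 trial (cell b0 ctrs g) (Op Add (rd b0 trial (cell b0 ctrs g)) (Const z)).

(** Probes all arrays within l1-distance [g] of the trial array by changing one
    cell up and down at each level.  The first recursive call covers the
    distances below [g], also those of the other parity. *)
Fixpoint search (g : nat) : prog :=
  if g is g'.+1 then
    Seq (search g')
      (for_ b0 ctrs g' size_e
        (Seq (nudge g' 1) (Seq (search g')
          (Seq (nudge g' (-2)) (Seq (search g') (nudge g' 1))))))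
  else probe.

(** One step of steepest descent.  The flag is lowered first, so that after the
    final round it speaks of the final divisor only. *)
Definition round B : prog :=
  Seq (fill trial (rd b0 held (var vCell))) (Seq eval_obj (Seq (set vBest (var vAcc))
    (Seq (set vGo (Const 0)) (Seq (set vFlag (Const 0)) (search B))))).

Definition descend B : prog := Seq (set vGo (Const 1)) (While (var vGo) (round B)).

Definition scale B : prog :=
  Seq (fill held (Op Add (rd b0 held (var vCell)) (rd b0 held (var vCell))))
    (Seq (descend B) (set vDiv (Op Div (var vDiv) (Const 2)))).

(** Turns the divisor, initially 1, into a power of two that exceeds the initial
    value of [vTop], without knowing any logarithm. *)
Definition grow : prog :=
  While (var vTop)
    (Seq (set vTop (Op Div (var vTop) (Const 2))) (set vDiv (Op Add (var vDiv) (var vDiv)))).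

Definition solve B : prog :=
  Seq (set vDiv (Const 1)) (Seq eval_obj (Seq (set vTop (var vAcc))
    (Seq grow (While (var vDiv) (scale B))))).

End SearchProgram.

Section SearchCorrect.
Variables (inp : store) (b0 : nat) (size_e target_e : expr) (eval_obj : prog).
Variables (E C : finType) (inc : C -> pred E) (v : C -> int).
Variables (rk : E -> nat) (N0 obj_time : nat) (k : E).
Hypothesis rk_inj : injective rk.
Hypothesis rk_lt : forall e, (rk e < N0)%N.

Local Notation obj := (obj inc v).
Local Notation run := (run inp b0).
Local Notation ev := (ev inp b0).

Definition table (row : nat -> int) : {ffun E -> int} := [ffun e => row (rk e)].

Definition obj_dirty (c a : nat) := (c == vars) && (a \in [:: vAcc; vSlice; vPos; vSum]).

(* The input reaches the search only through three program fragments: the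
   number of cells, the address of the target entry, and the penalty. *)
Hypothesis size_eE : forall st, ev st size_e = Posz N0.
Hypothesis target_eE : forall st, ev st target_e = Posz (rk k).
Hypothesis run_obj : forall st, run eval_obj st obj_time
  (fun st' => frame obj_dirty st st' /\
     st' vars vAcc = obj (st vars vDiv) (table (st trial))).

Definition fill_dirty (c : nat) (c' a : nat) :=
  (c' == c) || (c' == vars) && (a == vCell).

Lemma run_fill c e (val : nat -> int) st (R : wstate -> Prop) : c != vars ->
  (forall st' q, (q < N0)%N -> frame (fill_dirty c) st st' ->
     (forall q', (q <= q')%N -> st' c q' = st c q') -> st' vars vCell = Posz q ->
     ev st' e = val q)%N ->
  (forall st', frame (fill_dirty c) st st' ->
     (forall q, (q < N0)%N -> st' c q = val q) -> R st') ->
  run (fill b0 size_e c e) st (2 + N0 * 3) R.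
Proof.
move=> c2 he hR; pose I i st' := [/\ frame (fill_dirty c) st st',
  forall q, (q < i)%N -> st' c q = val q &
  forall q, (i <= q)%N -> st' c q = st c q].
apply: (run_for (I := I)) => [i st' _||i st' lt [h1 h2 h3] hi|st' [h1 h2 _]].
- exact: size_eE.
- split=> //; first by apply: frame_upd => //; rewrite /fill_dirty !eqxx orbT.
  by move=> q _; rewrite upd_other // xpair_eqE negb_and c2.
- apply: (run_wr (q := i)); first by rewrite ev_cell hi.
  have hv := he st' i lt h1 h3 hi; split.
    by rewrite upd_other // xpair_eqE negb_and eq_sym c2.
  split.
  + do 2![apply: frame_upd; first by rewrite /fill_dirty !eqxx ?orbT].
    exact: h1.
  + move=> q; rewrite ltnS leq_eqVlt => hq.
    rewrite upd_other; last by rewrite xpair_eqE negb_and c2.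
    case/orP: hq => [/eqP->|hq]; first by rewrite upd_same hv.
    by rewrite upd_other ?h2 // xpair_eqE negb_and (ltn_eqF hq) orbT.
  + move=> q hq; rewrite upd_other; last by rewrite xpair_eqE negb_and c2.
    by rewrite upd_other ?h3 ?(ltnW hq) // xpair_eqE negb_and (gtn_eqF hq) orbT.
exact: hR.
Qed.

Section OneSearch.
Variables (Q : int) (x0 : {ffun E -> int}).

Definition unique_at : Prop :=
  forall a b, obj Q a = 0 -> obj Q b = 0 -> a k = b k.

(** Invariant of a search for better arrays than [x0].  The flag never lies:
    it is raised only on two zeros of [obj Q] that differ at [k]. *)
Definition sound (st : wstate) : Prop :=
  [/\ st vars vDiv = Q, st vars vBest = obj Q (table (st held)),
      (st vars vGo = 0 /\ table (st held) = x0) \/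
      (st vars vGo = 1 /\ obj Q (table (st held)) < obj Q x0)
    & st vars vFlag = 0 \/ (st vars vFlag = 1 /\ ~ unique_at)].

(** What remains true of [z] once it has been probed, whatever is probed
    later: the array held is at least as good, and if [z] is a zero then the
    array held is a zero too, and agrees with [z] at [k] unless the flag is up. *)
Definition seen (st : wstate) (z : {ffun E -> int}) : Prop :=
  st vars vBest <= obj Q z /\
  (obj Q z = 0 -> z k = table (st held) k \/ st vars vFlag = 1).

Definition search_dirty g (c a : nat) :=
  [|| c == held, (c == vars) && (a \in [:: vAcc; vBest; vGo; vFlag; vSlice; vPos; vSum; vCell])
    | (c == ctrs) && (a < g)%N].

Definition found g (xs : {ffun E -> int} -> Prop) (st st' : wstate) : Prop :=
  [/\ sound st', frame (search_dirty g) st st',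
      forall z, seen st z -> seen st' z & forall z, xs z -> seen st' z].

Definition probe_steps := (obj_time + ((1 + (1 + (2 + N0 * 3))).+1 + 5))%N.

Lemma sound_seen_ext st st' : st' held = st held ->
  (forall a, a \in [:: vBest; vGo; vFlag; vDiv] -> st' vars a = st vars a) ->
  sound st -> sound st' /\ forall z, seen st z -> seen st' z.
Proof. by move=> e1 e2; rewrite /sound /seen e1 !e2. Qed.

(** Replacing the array held cannot spoil the facts recorded by [seen]: it
    happens only when its penalty was positive, and then no zero was probed. *)
Lemma run_probe st : sound st ->
  run (probe b0 size_e target_e eval_obj) st probe_steps
    (found 0 (fun z => z = table (st trial)) st).
Proof.
move=> sd; set x := table (st trial).
apply: run_seq; first exact: run_obj.
move=> st1 [f1 acc1]; have q4 : st vars vDiv = Q by case: sd.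
rewrite q4 -/x in acc1.
have [sd1 mono1] : sound st1 /\ forall z, seen st z -> seen st1 z.
  apply: sound_seen_ext sd; first by apply: functional_extensionality => a; apply: f1.
  by move=> a; rewrite !inE => /or4P[] /eqP->; apply: f1.
have x1 : table (st1 trial) = x by apply/ffunP => e; rewrite !ffunE f1.
pose R2 st2 := [/\ sound st2, frame (search_dirty 0) st st2,
  forall z, seen st z -> seen st2 z, st2 vars vAcc = obj Q x /\ table (st2 trial) = x
  & st2 vars vBest <= obj Q x].
apply: (run_seq (R1 := R2)).
  have fr1 : frame (search_dirty 0) st st1.
    apply: frame_le f1 => c a; rewrite /obj_dirty /search_dirty => /andP[/eqP-> ha] /=.
    by move: ha; rewrite !inE => /or4P[] ->; rewrite ?orbT.
  apply: run_if; rewrite ev_op !ev_cell /= acc1 => h; last first.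
    by apply: run_skip; split=> //; move: h; rewrite subr_le0.
  apply: (@run_seq _ _ _ _ _ _ _ (fun st' => st' = upd st1 vars vBest (obj Q x))).
    by apply: run_set; rewrite ev_cell acc1.
  move=> _ ->; set st1' := upd _ _ _ _.
  apply: run_seq; first by apply: (run_set (R := fun st' => st' = upd st1' vars vGo 1)).
  move=> _ ->; set st1'' := upd _ _ _ _.
  apply: (run_fill (val := st trial)) => // [st' q _ f _ h9|st' f hv].
    by rewrite (ev_rd _ (q := q)) ?ev_cell // f //; apply: f1.
  have y1 : table (st' held) = x by apply/ffunP => e; rewrite !ffunE hv.
  have hle : obj Q x < st1 vars vBest by move: h; rewrite subr_gt0.
  have hge := obj_ge0 inc v Q x.
  have e1 : st' vars vBest = obj Q x by rewrite f.
  have e2 : st' vars vGo = 1 by rewrite f.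
  have e3 : st' vars vFlag = st1 vars vFlag by rewrite f.
  split.
  - case: sd1 => s1 s2 s3 s4; split; rewrite ?y1 ?e1 ?e2 ?e3 //.
      by rewrite f.
    right; split=> //; apply: lt_le_trans hle _; rewrite s2.
    by case: s3 => -[_]; [move=> -> | apply: ltW].
  - apply: frame_trans fr1 (_ : frame (search_dirty 0) st1 st') => //.
    apply: (@frame_trans _ (fill_dirty held) _ st1 st1'') f.
    + by move=> c a h'; exact: h'.
    + move=> c a; rewrite /fill_dirty /search_dirty => /orP[->//|/andP[/eqP-> /eqP->]].
      by [].
    + by do 2![apply: frame_upd => //].
  - move=> z /mono1[z1 z2]; split; first by rewrite e1 (le_trans (ltW hle)).
    by move=> z0; move: z1 hle hge; rewrite z0; lia.
  - split; first by rewrite f // /st1'' /= upd_other // upd_other // acc1.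
    by rewrite -x1; apply/ffunP => e; rewrite !ffunE f.
  - by rewrite e1.
move=> st2 [sd2 fr2 mono2 [acc2 x2] le2].
have fin b : (b = 0 \/ (b = 1 /\ ~ unique_at)) -> (b = st2 vars vFlag \/ b = 1) ->
    (obj Q x = 0 -> x k = table (st2 held) k \/ b = 1) ->
    forall st', st' = upd st2 vars vFlag b -> found 0 (fun z => z = x) st st'.
  move=> hb1 hb2 hb3 st' e'.
  have e1 : st' held = st2 held by rewrite e'.
  have e2 : st' vars vBest = st2 vars vBest by rewrite e'.
  have e3 : st' vars vFlag = b by rewrite e'.
  split.
  - by case: sd2 => s1 s2 s3 s4; split; rewrite ?e1 ?e2 ?e3 // e'.
  - by rewrite e'; apply: frame_upd.
  - move=> z /mono2[z1 z2]; split; rewrite ?e1 ?e2 ?e3 // => /z2[->|hb]; first by left.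
    by right; case: hb2 => // ->.
  - by move=> _ ->; split; rewrite ?e1 ?e2 ?e3.
have updid : st2 = upd st2 vars vFlag (st2 vars vFlag).
  apply: functional_extensionality => c; apply: functional_extensionality => a.
  by rewrite /upd; case: andP => // -[/eqP-> /eqP->].
have s3 : st2 vars vFlag = 0 \/ st2 vars vFlag = 1 /\ ~ unique_at by case: sd2.
have rowk st' c : ev st' (rd b0 c target_e) = st' c (rk k) by apply: ev_rd.
have tk (st' : wstate) c : table (st' c) k = st' c (rk k) by rewrite ffunE.
apply: run_if; rewrite ev_cell acc2 => h.
  apply: run_skip; apply: (fin (st2 vars vFlag)) => //; first by left.
  by move=> z0; move: h; rewrite z0 ltxx.
have ox : obj Q x = 0 by apply/eqP; rewrite eq_le h obj_ge0.
have oy : obj Q (table (st2 held)) = 0.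
  by apply/eqP; rewrite eq_le obj_ge0 andbT -ox; case: sd2 => _ <-.
have [xy|xy] := eqVneq (x k) (table (st2 held) k).
  have same st' : st' = st2 -> ev st' (rd b0 trial target_e) = ev st' (rd b0 held target_e).
    by move=> ->; rewrite !rowk -!tk x2.
  apply: (@run_seq _ _ _ _ _ 2 2 (fun st' => st' = st2)).
    by apply: run_if; rewrite ev_op same //= subrr // => _; apply: run_skip.
  move=> _ ->; apply: run_if; rewrite ev_op same //= subrr // => _.
  by apply: run_skip; apply: (fin (st2 vars vFlag)) => //; left.
have nu : ~ unique_at by move=> u; case/eqP: xy; apply: u.
have done1 st' : st' = upd st2 vars vFlag 1 -> found 0 (fun z => z = x) st st'.
  by apply: fin; right.
apply: (@run_seq _ _ _ _ _ 2 2 (fun st' => st' = upd st2 vars vFlag 1 \/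
  (st' = st2 /\ x k < table (st2 held) k))).
  apply: run_if; rewrite ev_op !rowk -!tk x2 /= => h'.
    by apply: run_set; left.
  by apply: run_skip; right; split=> //; rewrite lt_neqAle xy -subr_le0.
move=> st3 h3; apply: run_if => h'.
  apply: run_set; apply: done1; case: h3 => [->|[-> _]] //.
  apply: functional_extensionality => c; apply: functional_extensionality => a.
  by rewrite /upd; case: andP.
apply: run_skip; case: h3 => [/done1//|[e3 lt]].
by move: h'; rewrite e3 ev_op !rowk -!tk x2 /= subr_le0 leNgt lt.
Qed.

Definition delta (e : E) : {ffun E -> int} := [ffun e' => (e' == e)%:R].

Lemma norm1_step h g : (norm1 h <= g.+1)%N -> (norm1 h <= g)%N \/
  exists e h', (norm1 h' <= g)%N /\ (h = delta e + h' \/ h = h' - delta e).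
Proof.
move=> hg; have [->|nz] := eqVneq h 0.
  by left; rewrite /norm1 big1 // => e _; rewrite ffunE.
have [e he] : exists e, h e != 0.
  apply/existsP; apply: contraNT nz; rewrite negb_exists => /forallP z.
  by apply/eqP/ffunP => e; rewrite ffunE; apply/eqP; have := z e; rewrite negbK.
right; exists e.
have split_e h' : norm1 h' = (`|h' e| + \sum_(e' | e' != e) `|h' e'|)%N.
  exact: (bigD1 e).
have off (h' : {ffun E -> int}) : (forall e', e' != e -> h' e' = h e') -> (`|h' e| < `|h e|)%N ->
    (norm1 h' <= g)%N.
  move=> same lt; move: hg; rewrite !split_e.
  rewrite [X in _ -> (_ + X <= _)%N](eq_bigr (fun e' => `|h e'|%N)) => [|e' ne].
    by move: (\sum_(_ | _) _)%N => S; lia.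
  by rewrite same.
case: (ltP 0 (h e)) => sg.
  exists (h - delta e); split; last by left; rewrite addrC subrK.
  apply: off => [e' /negPf ne|]; rewrite !ffunE ?ne ?subr0 ?eqxx //.
  by move: (h e) sg => a /=; lia.
exists (h + delta e); split; last by right; rewrite addrK.
apply: off => [e' /negPf ne|]; rewrite !ffunE ?ne ?addr0 ?eqxx //.
by move: (h e) sg he => a /=; lia.
Qed.

Fixpoint search_steps (g : nat) : nat :=
  if g is g'.+1 then (search_steps g' + (2 + N0 * (2 * search_steps g' + 3).+2))%N
  else probe_steps.

Definition around g (x z : {ffun E -> int}) : Prop :=
  exists2 h, (norm1 h <= g)%N & z = x + h.

Lemma run_nudge g z i st (R : wstate -> Prop) : st ctrs g = Posz i ->
  R (upd st trial i (st trial i + z)) -> run (nudge b0 g z) st 1 R.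
Proof.
move=> hi hR; have e : ev st (cell b0 ctrs g) = Posz i by rewrite ev_cell.
by apply: (run_wr (q := i)) => //; rewrite ev_op (ev_rd _ e).
Qed.

Lemma table_upd st (e : E) z :
  table (upd st trial (rk e) (st trial (rk e) + z) trial) =
  table (st trial) + [ffun e' => (e' == e)%:R * z].
Proof.
apply/ffunP => e'; rewrite !ffunE /upd /= (inj_eq rk_inj).
by case: eqP => [->|_]; rewrite ?mul1r ?mul0r ?addr0.
Qed.

(** The trial array is restored cell by cell, so the outcome is the set of
    arrays probed, all measured from the same centre. *)
Lemma run_search g st : sound st ->
  run (search b0 size_e target_e eval_obj g) st (search_steps g)
    (found g (around g (table (st trial))) st).
Proof.
elim: g st => [|g IH] st sd /=.
  apply: run_post (run_probe sd) _ => st' [h1 h2 h3 h4]; split=> // z [h].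
  rewrite leqn0 sum_nat_eq0 => /forallP h0 ->; apply: h4.
  apply/ffunP => e; rewrite !ffunE; have := h0 e.
  by rewrite absz_eq0 => /eqP->; rewrite addr0.
set x := table (st trial).
apply: run_seq; first exact: IH.
move=> st1 [sd1 f1 m1 s1].
pose I i st' := [/\ sound st', frame (search_dirty g.+1) st st',
  forall z, seen st z -> seen st' z, forall z, around g x z -> seen st' z &
  forall e h, (rk e < i)%N -> (norm1 h <= g)%N ->
    seen st' (x + (delta e + h)) /\ seen st' (x + (h - delta e))].
have DS c a : search_dirty g c a -> search_dirty g.+1 c a.
  by rewrite /search_dirty; case/or3P=> [->//|->|/andP[-> /ltnW h]]; rewrite ?orbT // ltnS h !orbT.
have sound_off st' c a z : c != held -> c != vars -> sound st' ->
    sound (upd st' c a z) /\ forall z', seen st' z' -> seen (upd st' c a z) z'.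
  move=> c1 c2; apply: sound_seen_ext => [|a' _].
    apply: functional_extensionality => a'; rewrite upd_other //.
    by rewrite xpair_eqE negb_and eq_sym c1.
  by rewrite upd_other // xpair_eqE negb_and eq_sym c2.
apply: (run_for (I := I)) => [i st' _|||st'].
- exact: size_eE.
- have [h1 h2] := @sound_off st1 ctrs g 0 isT isT sd1.
  split=> //.
  + apply: frame_upd; first by rewrite /search_dirty !eqxx ltnSn !orbT.
    exact: frame_le DS f1.
- move=> i st2 lt [sd2 f2 m2 s2 t2] hi.
  have x2 : table (st2 trial) = x by apply/ffunP => e; rewrite !ffunE f2.
  apply: (@run_weak _ _ _ _ (1 + (search_steps g + (1 + (search_steps g + 1)))));
    [|by lia|by move=> st' h; exact: h].
  apply: (@run_seq _ _ _ _ _ _ _ (fun st' => st' = upd st2 trial i (st2 trial i + 1))).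
    exact: run_nudge hi _.
  move=> _ ->; set st3 := upd _ _ _ _.
  have [sd3 m3] : sound st3 /\ forall z, seen st2 z -> seen st3 z by apply: sound_off.
  apply: run_seq; first exact: IH sd3.
  move=> st4 [sd4 f4 m4 s4].
  have hi4 : st4 ctrs g = Posz i by rewrite f4 // /search_dirty ltnn.
  apply: (@run_seq _ _ _ _ _ _ _ (fun st' => st' = upd st4 trial i (st4 trial i - 2))).
    exact: run_nudge hi4 _.
  move=> _ ->; set st5 := upd _ _ _ _.
  have [sd5 m5] : sound st5 /\ forall z, seen st4 z -> seen st5 z by apply: sound_off.
  apply: run_seq; first exact: IH sd5.
  move=> st6 [sd6 f6 m6 s6].
  have hi6 : st6 ctrs g = Posz i by rewrite f6 // /search_dirty ltnn.
  apply: (run_nudge hi6); set st7 := upd _ _ _ _.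
  have [sd7 m7] : sound st7 /\ forall z, seen st6 z -> seen st7 z by apply: sound_off.
  have hi7 : st7 ctrs g = Posz i := hi6.
  split=> //.
  have [sd8 m8] := @sound_off st7 ctrs g i.+1 isT isT sd7.
  (* The three changes of cell i, by 1, -2 and 1, cancel. *)
  have f7 : frame (search_dirty g) st2 st7.
    move=> c a nd; case: (eqVneq (c, a) (trial, i)) => [[-> ->]|ne].
      rewrite /st7 upd_same f6 // /st5 upd_same f4 // /st3 upd_same.
      by move: (st2 trial i) => w; lia.
    by rewrite /st7 upd_other // f6 // /st5 upd_other // f4 // /st3 upd_other.
  have m28 z : seen st2 z -> seen (upd st7 ctrs g (Posz i.+1)) z.
    by move=> /m3/m4/m5/m6/m7/m8.
  split=> //.
  + apply: frame_upd; first by rewrite /search_dirty !eqxx ltnSn !orbT.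
    by move=> c a nd; rewrite f7 ?f2 //; apply: contra nd; apply: DS.
  + by move=> z /m2/m28.
  + by move=> z /s2/m28.
  + move=> e h; rewrite ltnS leq_eqVlt => /orP[/eqP ei|lt'] hh; last first.
      by have [h1 h2] := t2 e h lt' hh; split; apply: m28.
    have x3 : table (st3 trial) = x + delta e.
      rewrite /st3 -ei table_upd x2; congr (_ + _).
      by apply/ffunP => e'; rewrite !ffunE mulr1.
    have x5 : table (st5 trial) = x - delta e.
      have x4 : table (st4 trial) = x + delta e.
        by rewrite -x3; apply/ffunP => e'; rewrite !ffunE f4.
      rewrite /st5 -ei table_upd x4 -addrA; congr (_ + _).
      by apply/ffunP => e'; rewrite !ffunE; case: eqP.
    split; [apply/m8/m7/m6/m5/s4 | apply/m8/m7/s6]; exists h => //.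
      by rewrite x3 addrA.
    by rewrite x5 -!addrA; congr (_ + _); rewrite addrC.
move=> [sd' f' m' s' t']; split=> // z [h hg ->].
have [hs|[e [h' [hs [->|->]]]]] := norm1_step hg.
- by apply: s'; exists h.
- by have [] := t' e h' (rk_lt e) hs.
- by have [] := t' e h' (rk_lt e) hs.
Qed.

End OneSearch.

Variable B : nat.
Hypothesis short : forall h : {ffun E -> int}, h != 0 ->
  exists g, [/\ g != 0, (norm1 g <= B)%N & conformal inc g h].

Definition decided Q (st : wstate) : Prop :=
  (st vars vFlag = 0 /\ unique_at Q) \/ (st vars vFlag = 1 /\ ~ unique_at Q).

Definition optimal Q (st : wstate) : Prop :=
  forall y, obj Q (table (st held)) <= obj Q y.

Definition round_steps := (2 + N0 * 3 + (obj_time + (1 + (1 + (1 + search_steps B)))))%N.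

(** A round without improvement proves optimality by [local_opt_global], and then
    a lowered flag proves uniqueness by [short_witness]. *)
Lemma run_round Q st : st vars vDiv = Q ->
  run (round b0 size_e target_e eval_obj B) st round_steps (fun st' =>
    st' vars vDiv = Q /\
    ((st' vars vGo = 0 /\ optimal Q st' /\ decided Q st') \/
     (st' vars vGo = 1 /\ obj Q (table (st' held)) < obj Q (table (st held))))).
Proof.
move=> hQ; set y0 := table (st held).
apply: (@run_seq _ _ _ _ _ _ _ (fun st1 => frame (fill_dirty trial) st st1 /\
   table (st1 trial) = y0)).
  apply: (run_fill (val := st held)) => // [st' q _ f _ h9|st' f hv].
    by rewrite (ev_rd _ (q := q)) ?ev_cell // f.
  by split=> //; apply/ffunP => e; rewrite !ffunE hv.
move=> st1 [f1 x1]; apply: run_seq; first exact: run_obj.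
move=> st2 [f2 acc2].
have {}acc2 : st2 vars vAcc = obj Q y0 by rewrite acc2 x1 f1 // hQ.
apply: (@run_seq _ _ _ _ _ _ _ (fun st' => st' = upd st2 vars vBest (obj Q y0))).
  by apply: run_set; rewrite ev_cell acc2.
move=> _ ->; set st3 := upd _ _ _ _.
apply: (@run_seq _ _ _ _ _ _ _ (fun st' => st' = upd st3 vars vGo 0)).
  exact: run_set.
move=> _ ->; set st4 := upd _ _ _ _.
apply: (@run_seq _ _ _ _ _ _ _ (fun st' => st' = upd st4 vars vFlag 0)).
  exact: run_set.
move=> _ ->; set st5 := upd _ _ _ _.
have y5 : table (st5 held) = y0.
  by apply/ffunP => e; rewrite !ffunE -[st5 _ _]/(st2 held (rk e)) f2 // f1.
have x5 : table (st5 trial) = y0.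
  rewrite -x1; apply/ffunP => e.
  by rewrite !ffunE -[st5 _ _]/(st2 trial (rk e)) f2.
have sd5 : sound Q y0 st5.
  split=> //; [|by rewrite y5|by left|by left].
  by rewrite -[st5 _ _]/(st2 vars vDiv) f2 // f1.
apply: run_post (run_search B sd5) _ => st6 [[q6 b6 g6 u6] _ _ s6].
split=> //; case: g6 => [[go6 y6]|]; [left; split=> // | by right].
rewrite x5 in s6.
have near h : (norm1 h <= B)%N -> seen Q st6 (y0 + h).
  by move=> hh; apply: s6; exists h.
have opt : optimal Q st6.
  rewrite /optimal y6; apply: (local_opt_global short) => h hh.
  by rewrite -{1}y6 -b6; case: (near h hh).
split=> //; case: u6 => [f0|]; [left; split=> // | by right].
have same a : obj Q a = 0 -> a k = y0 k.
  move=> a0; apply/eqP/negPn/negP => /eqP ne.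
  have z0 : obj Q y0 = 0.
    by apply/eqP; rewrite eq_le obj_ge0 andbT -a0 -y6 opt.
  have ne' : y0 k <> a k by move=> e; apply: ne.
  have [h [hh h0 hk]] := short_witness short z0 a0 ne'.
  case: (near h hh) => _ /(_ h0); rewrite y6 f0 => -[|//]; exact: hk.
by move=> a b /same-> /same->.
Qed.

Local Notation G := (gap E C).

Definition descend_steps := (1 + (1 + G.+1 * round_steps.+1))%N.

(** Every round but the last lowers the integer penalty. *)
Lemma run_descend Q st : st vars vDiv = Q ->
  (forall y, obj Q (table (st held)) <= obj Q y + G%:Z) ->
  run (descend b0 size_e target_e eval_obj B) st descend_steps
    (fun st' => [/\ st' vars vDiv = Q, optimal Q st' & decided Q st']).
Proof.
move=> hQ hG.
apply: (@run_seq _ _ _ _ _ _ _ (fun st' => st' = upd st vars vGo 1)); first exact: run_set.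
move=> _ ->; (* m is 1 plus a bound on the distance to the minimum. *)
pose I m st' := st' vars vDiv = Q /\
  ((st' vars vGo = 0 /\ optimal Q st' /\ decided Q st') \/
   (st' vars vGo = 1 /\ (0 < m)%N /\
    forall y, obj Q (table (st' held)) <= obj Q y + m.-1%:Z)).
apply: (run_while (I := I)).
- move=> m st' [q' h]; rewrite ev_cell => le; case: h => [[_ []]//|[e]].
  by move: le; rewrite e.
- move=> m st' [q' [[e _]|[e [m0 hm]]]]; rewrite ev_cell e // => _.
  apply: run_post (run_round q') _ => st2 [q2 [h|[g2 lt]]].
    by exists 0%N => //; split=> //; left.
  have h2 := hm (table (st2 held)).
  exists m.-1; first by rewrite prednK.
  split=> //; right; split=> //.
  move: h2 lt; move: (obj Q (table (st2 held))) => z h2 lt.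
  split; first by move: (obj _ _) h2 lt => w; lia.
  by move=> y; move: (hm y) lt h2; move: (obj Q y) (obj Q _) => w w'; lia.
by split=> //; right.
Qed.

Definition scale_steps := (2 + N0 * 3 + (descend_steps + 1))%N.

Lemma run_scale Q st : st vars vDiv = Q ->
  (forall y, obj Q (table (st held) + table (st held)) <= obj Q y + G%:Z) ->
  run (scale b0 size_e target_e eval_obj B) st scale_steps
    (fun st' => [/\ st' vars vDiv = (Q %/ 2)%Z, optimal Q st' & decided Q st']).
Proof.
move=> hQ hG; apply: (@run_seq _ _ _ _ _ _ _ (fun st1 => st1 vars vDiv = Q /\
   table (st1 held) = table (st held) + table (st held))).
  apply: (run_fill (val := fun q => st held q + st held q)) => // [st' q _ f h h9|st' f hv].
    by rewrite ev_op (ev_rd _ (q := q)) ?ev_cell //= h.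
  by rewrite f //; split=> //; apply/ffunP => e; rewrite !ffunE hv.
move=> st1 [q1 y1]; apply: run_seq.
  by apply: run_descend q1 _; rewrite y1.
move=> st2 [q2 o2 d2]; apply: run_set.
by rewrite ev_op ev_cell q2.
Qed.

Variable J : nat.
Hypothesis obj0_lt : obj 1 0 < (2 ^ J)%N%:Z.

Definition solve_steps :=
  (1 + (obj_time + (1 + (1 + J * 3 + (1 + J.+1 * scale_steps.+1)))))%N.

(** Once the divisor has been halved to [2 ^ i], the array held is optimal for
    [2 ^ i.+1], and doubling it gives a start within [gap] of the minimum.  The penalty of the zero array at
    divisor 1 bounds all the prescribed sums, so a larger power of two is a
    divisor at which the zero array itself is such a start. *)
Lemma run_solve :
  run (solve b0 size_e target_e eval_obj B) (fun _ _ => 0) solve_steps (decided 1).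
Proof.
set st0 : wstate := fun _ _ => 0.
have zero_table (st : wstate) : (forall a, st held a = 0) -> table (st held) = 0.
  by move=> h; apply/ffunP => e; rewrite !ffunE h.
apply: (@run_seq _ _ _ _ _ _ _ (fun st' => st' = upd st0 vars vDiv 1)); first exact: run_set.
move=> _ ->; apply: run_seq; first exact: run_obj.
move=> st1 [f1 acc1]; rewrite -[upd _ _ _ _ _ _]/(1 : int) in acc1.
have x0 : table (upd st0 vars vDiv 1 trial) = 0 by apply/ffunP => e; rewrite !ffunE.
rewrite x0 in acc1; have q1 : st1 vars vDiv = 1 by rewrite f1.
have [t0 e0] : exists t0, obj 1 0 = Posz t0.
  by exists (absz (obj 1 0)); rewrite gez0_abs ?obj_ge0.
apply: (@run_seq _ _ _ _ _ _ _ (fun st' => st' = upd st1 vars vTop t0)).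
  by apply: run_set; rewrite ev_cell acc1 e0.
move=> _ ->; pose I m (st' : wstate) := exists j, [/\ (j + m = J)%N, st' vars vDiv = (2 ^ j)%N,
  st' vars vTop = (t0 %/ 2 ^ j)%N & forall a, st' held a = 0].
apply: (@run_seq _ _ _ _ _ _ _ (fun st' : wstate => exists j, [/\ (j <= J)%N,
   st' vars vDiv = (2 ^ j)%N, (t0 < 2 ^ j)%N & forall a, st' held a = 0])).
  apply: (run_while (I := I)); last first.
  - exists 0%N; rewrite add0n expn0 divn1; split=> // a.
    by rewrite -[upd _ _ _ _ _ _]/(st1 held a) f1.
  - move=> m st' [j [jm q' t' y']]; rewrite ev_cell t' => pos.
    have ltj : (j < J)%N.
      have lt0 := obj0_lt; rewrite e0 ltz_nat in lt0.
      rewrite -(@ltn_exp2l 2) //; apply: leq_ltn_trans lt0.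
      by move: pos; rewrite -[0]/(Posz 0) ltz_nat divn_gt0 // expn_gt0.
    apply: (@run_seq _ _ _ _ _ 1 1 (fun st2 => st2 = upd st' vars vTop (t0 %/ 2 ^ j.+1)%N)).
      by apply: run_set; rewrite ev_op ev_cell t' /= divz_nat expnSr divnMA.
    move=> _ ->; apply: run_set; exists m.-1; first by lia.
    exists j.+1; split=> //; first by lia.
    rewrite upd_same ev_op !ev_cell /= -[upd _ _ _ _ _ _]/(st' vars vDiv) q'.
    by rewrite -PoszD expnS mul2n addnn.
  - move=> m st' [j [jm q' t' y']]; rewrite ev_cell t' => le.
    exists j; split=> //; first by lia.
    have : (t0 %/ 2 ^ j = 0)%N by apply/eqP; rewrite -leqn0 -lez_nat.
    by move/eqP; rewrite -leqn0 leqNgt divn_gt0 ?expn_gt0 // -ltnNge.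
move=> st2 [j [jJ q2 t2 y2]].
(* m counts the divisors still to be treated; it is 0 after divisor 1. *)
pose I' m (st' : wstate) := (m = 0%N /\ st' vars vDiv = 0 /\ decided 1 st') \/
  exists i, [/\ m = i.+1, st' vars vDiv = (2 ^ i)%N & forall y,
    obj (2 ^ i)%N (table (st' held) + table (st' held)) <= obj (2 ^ i)%N y + G%:Z].
apply: (@run_weak _ _ _ _ (1 + j.+1 * scale_steps.+1) (decided 1)) => //; last first.
  by rewrite leq_add2l leq_mul2r ltnS jJ orbT.
apply: (run_while (I := I')).
- move=> m st' [[_ [_ //]]|[i [_ q' _]]]; rewrite ev_cell q' => le.
  by have := expn_gt0 2 i; lia.
- move=> m st' [[_ [e _]]|[i [-> q' h']]]; first by rewrite ev_cell e.
  move=> _; apply: run_post (run_scale q' h') _ => st3 [q3 o3 d3].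
  case: i q3 o3 d3 {q' h'} => [|i] q3 o3 d3.
    by exists 0%N => //; left.
  exists i.+1 => //; right; exists i; split=> //.
    by rewrite q3 divz_nat expnS mulKn.
  apply: gap_scale; first by rewrite ltz_nat expn_gt0.
  by rewrite -PoszD addnn -mul2n -expnS.
right; exists j; split=> //; rewrite !zero_table //; apply: gap_top => c.
apply: le_lt_trans (_ : Posz t0 < _); last by [].
rewrite -e0; exact: sum_le_obj0.
Qed.

End SearchCorrect.

(** * Splitting a table into slices *)
Section Coordinates.
Variables (d : nat) (m : d.-tuple nat).

Lemma dim_last n : Defs.dim m n ord_max = n.
Proof. by rewrite /Defs.dim (tnth_nth 0%N) nth_rcons size_tuple ltnn eqxx. Qed.

Lemma dim_local n n' (j : 'I_d.+1) : j != ord_max -> Defs.dim m n j = Defs.dim m n' j.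
Proof.
move=> jm; rewrite /Defs.dim !(tnth_nth 0%N) !nth_rcons size_tuple.
suff -> : (j < d)%N by [].
by move: jm (ltn_ord j); rewrite -val_eqE /= ltnS leq_eqVlt => /negPf->.
Qed.

Definition entry_of n (f : 'I_d.+1 -> nat) (h : forall j, (f j < Defs.dim m n j)%N) :
  entry m n := [ffun j => Ordinal (h j)].

Lemma entry_ext n (e e' : entry m n) : (forall j, e j = e' j :> nat) -> e = e'.
Proof. by move=> h; apply/ffunP => j; apply: val_inj; apply: h. Qed.

Definition restr n (j : 'I_d.+1) (e : entry m n) : line m n j :=
  [ffun l : 'I_d => e (lift j l)].

Definition agree_off n (j : 'I_d.+1) (e e' : entry m n) : bool :=
  [forall l, (l != j) ==> (e' l == e l)].

Lemma on_line_restr n j (e e' : entry m n) :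
  on_line (restr j e) e' = agree_off j e e'.
Proof.
apply/forallP/forallP => [h l|h l]; last first.
  by rewrite ffunE; apply: (implyP (h (lift j l))); rewrite eq_sym neq_lift.
apply/implyP => lj; case: (unliftP j l) lj => [l' -> _|->]; last by rewrite eqxx.
by have := h l'; rewrite ffunE.
Qed.

Section Slices.
Variable n : nat.

(** Entries of a table with [n] slices correspond to pairs of an entry of a table
    with a single slice, a type that depends on [d] and [m] only, and the number
    of the slice. *)
Definition glue_fun (a : entry m 1) (i : nat) (j : 'I_d.+1) : nat :=
  if j == ord_max then i else a j.

Lemma glue_lt a (i : 'I_n) j : (glue_fun a i j < Defs.dim m n j)%N.
Proof.
rewrite /glue_fun; case: eqP => [->|/eqP jm]; first by rewrite dim_last.
by rewrite (dim_local n 1 jm).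
Qed.

Definition glue (p : entry m 1 * 'I_n) : entry m n := entry_of (glue_lt p.1 p.2).

Lemma local_lt (e : entry m n) j :
  ((if j == ord_max then 0 else e j) < Defs.dim m 1 j)%N.
Proof.
case: eqP => [->|/eqP jm]; first by rewrite dim_last.
by rewrite (dim_local 1 n jm).
Qed.

Definition local (e : entry m n) : entry m 1 := entry_of (local_lt e).

Definition slice (e : entry m n) : 'I_n := cast_ord (dim_last n) (e ord_max).

Lemma glueK : cancel glue (fun e => (local e, slice e)).
Proof.
move=> [a i]; congr pair; last by apply: val_inj; rewrite /= ffunE /= /glue_fun eqxx.
apply: entry_ext => j; rewrite ffunE /=; case: eqP => [->|/eqP jm].
  by have := ltn_ord (a ord_max); rewrite {2}dim_last; case: (nat_of_ord _).
by rewrite ffunE /= /glue_fun (negPf jm).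
Qed.

Lemma localK : cancel (fun e => (local e, slice e)) glue.
Proof.
move=> e; apply: entry_ext => j; rewrite ffunE /= /glue_fun.
by case: eqP => [->|/eqP jm] //=; rewrite ffunE /= (negPf jm).
Qed.

Lemma sum_glue (R : nmodType) (P : pred (entry m n)) (F : entry m n -> R) :
  \sum_(e | P e) F e = \sum_a \sum_(i | P (glue (a, i))) F (glue (a, i)).
Proof.
rewrite pair_big_dep /= (reindex glue) /=; last first.
  by exists (fun e => (local e, slice e)) => e _; [apply: glueK | apply: localK].
by apply: eq_big => [[a i]|[a i]].
Qed.

Lemma agree_off_glue j a i a' i' :
  agree_off j (glue (a, i)) (glue (a', i')) =
  if j == ord_max then a == a' else (i == i') && agree_off j a a'.
Proof.
have gE l b i1 : glue (b, i1) l = glue_fun b i1 l :> nat by rewrite ffunE.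
case: eqP => [->|/eqP jm].
  apply/forallP/eqP => [h|-> l]; last first.
    by apply/implyP => lm; rewrite -val_eqE /= !gE /glue_fun (negPf lm).
  apply: entry_ext => l; have [->|lm] := eqVneq l ord_max.
    have := ltn_ord (a ord_max); have := ltn_ord (a' ord_max).
    by rewrite {2 4}dim_last; case: (nat_of_ord _) => // _; case: (nat_of_ord _).
  have := implyP (h l) lm; rewrite -val_eqE /= !gE /glue_fun (negPf lm) => /eqP.
  by [].
apply/forallP/andP => [h|[/eqP-> /forallP h] l].
  split.
    have := implyP (h ord_max); rewrite eq_sym => /(_ jm).
    by rewrite -val_eqE /= !gE /glue_fun eqxx eq_sym.
  apply/forallP => l; apply/implyP => lj; have [->|lm] := eqVneq l ord_max.
    rewrite -val_eqE /=.
    have := ltn_ord (a ord_max); have := ltn_ord (a' ord_max).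
    by rewrite {2 4}dim_last; case: (nat_of_ord _) => // _; case: (nat_of_ord _).
  by have := implyP (h l) lj; rewrite -!val_eqE /= !gE /glue_fun (negPf lm).
apply/implyP => lj; rewrite -val_eqE /= !gE /glue_fun; case: ifP => // _.
exact: (implyP (h l) lj).
Qed.

Definition incident (c : 'I_d.+1 * entry m n) : pred (entry m n) :=
  on_line (restr c.1 c.2).

Lemma along_glue (x : {ffun entry m n -> int}) j a i :
  along incident (j, glue (a, i)) x =
  if j == ord_max then \sum_i' x (glue (a, i'))
  else \sum_(a' | agree_off j a a') x (glue (a', i)).
Proof.
rewrite /along sum_glue /incident /=.
under eq_bigr do under eq_bigl do rewrite on_line_restr agree_off_glue.
have [_|_] := eqVneq j ord_max.
  rewrite (bigD1 a) //= [X in _ + X]big1 ?addr0; first by apply: eq_bigl => i'; rewrite eqxx.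
  by move=> a' ne; rewrite big_pred0 // => i'; rewrite eq_sym (negPf ne).
rewrite [RHS]big_mkcond; apply: eq_bigr => a' _; case: (agree_off j a a').
  by rewrite (big_pred1 i) // => i'; rewrite andbT eq_sym.
by rewrite big_pred0 // => i'; rewrite andbF.
Qed.

End Slices.

(** [short_conformal] with the lines in the first [d] coordinates as constraints
    within a slice; the lines along the last one are the sums across slices. *)
Lemma short_moves : exists B, forall n (h : {ffun entry m n -> int}), h != 0 ->
  exists g : {ffun entry m n -> int},
    [/\ g != 0, (norm1 g <= B)%N & conformal (@incident n) g h].
Proof.
have [B hB] := @short_conformal (entry m 1) ('I_d.+1 * entry m 1)%type
  (fun c a => agree_off c.1 c.2 a).
exists B => n h nz.
have [|g [[a [i gnz]] gB ce cl cc]] := hB n (fun a i => h (glue (a, i))).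
  have [e he] : exists e, h e != 0.
    apply/existsP; apply: contraNT nz; rewrite negb_exists => /forallP z.
    by apply/eqP/ffunP => e; rewrite ffunE; apply/eqP; have := z e; rewrite negbK.
  by exists (local e), (slice e); rewrite (localK e).
pose G : {ffun entry m n -> int} := [ffun e => g (local e) (slice e)].
have GE a' i' : G (glue (a', i')) = g a' i'.
  by rewrite ffunE; have [-> ->] := glueK (a', i').
exists G; split.
- by apply: contra gnz => /eqP G0; rewrite -GE G0 ffunE.
- apply: leq_trans gB; rewrite /norm1 (sum_glue (R := nat) predT).
  by apply: leq_sum => a' _; apply: leq_sum => i' _; rewrite GE.
split=> [e|[j e]].
  by rewrite -(localK e) GE.
rewrite -(localK e) !along_glue; have [jm|jm] := eqVneq j ord_max.
  by under eq_bigr do rewrite GE; apply: cc.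
under eq_bigr do rewrite GE; exact: (cl (j, local e) (slice e)).
Qed.

End Coordinates.

(** * Evaluating the penalty on the machine *)
(** Multiplication by a constant as repeated addition, which keeps the program
    free of products. *)
Definition mulc (c : nat) (e : expr) : expr := iter c (Op Add e) (Const 0).
Definition esum (es : seq expr) : expr := foldr (Op Add) (Const 0) es.
Definition seqs (ps : seq prog) : prog := foldr Seq Skip ps.

Lemma eval_mulc s c e : eval s (mulc c e) = c%:Z * eval s e.
Proof. by elim: c => [|c IH] /=; rewrite ?mul0r // IH intS mulrDl mul1r. Qed.

Lemma eval_esum s es : eval s (esum es) = \sum_(e <- es) eval s e.
Proof. by elim: es => [|e es IH] /=; rewrite ?big_nil // big_cons IH. Qed.

Section ObjectiveProgram.
Variables (d : nat) (m : d.-tuple nat).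
Let b0 : nat := d.+2.

(** Addresses of entries are mixed radix numbers.  The last coordinate is the most
    significant one, so the weights do not depend on the number of slices. *)
Definition weight (j : 'I_d.+1) : nat :=
  (\prod_(l < d.+1 | l < j) Defs.dim m 1 l)%N.

Definition rank_fun (f : 'I_d.+1 -> nat) : nat := (\sum_j weight j * f j)%N.

Definition rank_e (ce : 'I_d.+1 -> expr) : expr :=
  esum [seq mulc (weight j) (ce j) | j <- enum 'I_d.+1].

Definition line_weight (j : 'I_d.+1) (l : 'I_d) : nat :=
  (\prod_(l' < d | l' < l) Defs.dim m 1 (lift j l'))%N.

Definition line_e (j : 'I_d.+1) (ce : 'I_d.+1 -> expr) : expr :=
  esum [seq mulc (line_weight j l) (ce (lift j l)) | l <- enum 'I_d].

Definition n_e : expr := Read 0 (Const 0).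

Definition dim_e (j : 'I_d.+1) : expr :=
  if j == ord_max then n_e else Const (Defs.dim m 1 j)%:Z.

(** A convenient bound, linear in [n], on the addresses of all entries.  The
    cells below it that belong to no entry do not influence the penalty. *)
Definition size_e : expr :=
  mulc (\sum_j weight j * Defs.dim m 1 j).+1 n_e.

Definition target_e : expr := rank_e (fun j => Read 0 (Const j.+1%:Z)).

Definition coord_e (a : entry m 1) (j : 'I_d.+1) : expr :=
  if j == ord_max then var b0 vSlice else Const (a j : nat)%:Z.

Definition add_abs (e : expr) : prog :=
  If e (set b0 vAcc (Op Add (var b0 vAcc) e)) (set b0 vAcc (Op Defs.Sub (var b0 vAcc) e)).

Definition add_neg (e : expr) : prog :=
  If e Skip (set b0 vAcc (Op Defs.Sub (var b0 vAcc) e)).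

(** The line is traversed by overriding the coordinate [j] with the running
    position, so all coordinates, the last one included, share this code. *)
Definition add_line (ce : 'I_d.+1 -> expr) (j : 'I_d.+1) : prog :=
  Seq (set b0 vSum (Const 0))
    (Seq (for_ b0 vars vPos (dim_e j)
            (set b0 vSum (Op Add (var b0 vSum)
               (rd b0 trial (rank_e (fun l => if l == j then var b0 vPos else ce l))))))
         (add_abs (Op Defs.Sub (Op Div (Read j.+1 (line_e j ce)) (var b0 vDiv))
                               (var b0 vSum)))).

Definition add_entry (a : entry m 1) : prog :=
  Seq (add_neg (rd b0 trial (rank_e (coord_e a))))
      (seqs [seq add_line (coord_e a) j | j <- enum 'I_d.+1]).

(** The loop runs over the slices; the entries within a slice are unrolled, their
    number being fixed. *)
Definition eval_obj : prog :=
  Seq (set b0 vAcc (Const 0))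
      (for_ b0 vars vSlice n_e (seqs [seq add_entry a | a <- enum (entry m 1)])).

Section Instance.
Variables (n : nat) (v : line_sums m n) (k : entry m n).
Hypothesis n_gt0 : (0 < n)%N.
Let inp := input v k.
Local Notation run := (run inp b0).
Local Notation ev := (ev inp b0).

Definition rank (e : entry m n) : nat := rank_fun (fun j => e j).

Definition sums (c : 'I_d.+1 * entry m n) : int := v (restr c.1 c.2).

Local Notation obj := (obj (@incident _ m n) sums).
Local Notation table := (table rank).

Lemma weightE (j : 'I_d.+1) :
  weight j = (\prod_(l < d.+1 | l < j) Defs.dim m n l)%N.
Proof.
apply: eq_bigr => l lj; apply: dim_local; rewrite -val_eqE /=.
by rewrite neq_ltn (leq_trans lj) // -ltnS.
Qed.

Lemma line_weightE (j : 'I_d.+1) (l : 'I_d) :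
  line_weight j l = (\prod_(l' < d | l' < l) Defs.dim m n (lift j l'))%N.
Proof.
apply: eq_bigr => l' ll; apply: dim_local; rewrite -val_eqE /= /bump.
case: (j <= l')%N; rewrite ?add1n ?add0n neq_ltn.
  by rewrite (leq_ltn_trans ll (ltn_ord l)).
by rewrite (ltn_trans ll (ltn_ord l)).
Qed.

Lemma rank_inj : injective rank.
Proof.
move=> e e' h; apply: entry_ext.
apply: (mixed_radix_inj (N := Defs.dim m n)) => [l|l|]; try exact: ltn_ord.
under eq_bigr do rewrite -weightE mulnC.
by under [RHS]eq_bigr do rewrite -weightE mulnC.
Qed.

Lemma dim_le (j : 'I_d.+1) : (Defs.dim m n j <= Defs.dim m 1 j * n)%N.
Proof.
have [->|jm] := eqVneq j ord_max; first by rewrite !dim_last mul1n.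
by rewrite (dim_local m n 1 jm) leq_pmulr.
Qed.

Definition cells : nat := ((\sum_j weight j * Defs.dim m 1 j).+1 * n)%N.

Lemma rank_lt e : (rank e < cells)%N.
Proof.
rewrite /cells mulSn -[X in (X < _)%N]add0n -addSn leq_add //.
rewrite big_distrl; apply: leq_sum => j _ /=; rewrite -mulnA leq_mul2l.
by rewrite (leq_trans (ltnW (ltn_ord (e j)))) ?dim_le ?orbT.
Qed.

Lemma inp_n : inp 0%N 0 = n%:Z.
Proof. by []. Qed.

Lemma inp_k (j : 'I_d.+1) : inp 0%N j.+1%:Z = (k j : nat)%:Z.
Proof.
rewrite /inp /input /= (nth_map j) ?size_enum_ord //.
by rewrite nth_ord_enum.
Qed.

Lemma inp_sums (j : 'I_d.+1) (r : line m n j) :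
  inp j.+1 (line_rank r)%:Z = v r.
Proof.
rewrite /inp /input valK; case: pickP => [r' /eqP[] /line_rank_inj-> //|].
by move=> /(_ r); rewrite eqxx.
Qed.

Lemma inp_work : memory inp b0 (fun _ _ => 0) = inp.
Proof.
apply: functional_extensionality => b; apply: functional_extensionality => a.
rewrite /memory; case: ltnP => // hb; case: b hb => [//|b] hb.
rewrite /inp /input insubN -?leqNgt ?hb //.
  by case: a.
Qed.

Lemma ev_read st b e : (b < b0)%N -> ev st (Read b e) = inp b (ev st e).
Proof. by move=> hb; rewrite /ev /= {1}/memory hb. Qed.

Lemma ev_n st : ev st n_e = n%:Z.
Proof. by rewrite ev_read // inp_n. Qed.

Lemma ev_size st : ev st size_e = cells%:Z.
Proof. by rewrite /ev eval_mulc -/(ev st n_e) ev_n -PoszM. Qed.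

Lemma ev_rank st ce f : (forall j, ev st (ce j) = (f j)%:Z) ->
  ev st (rank_e ce) = (rank_fun f)%:Z.
Proof.
move=> h; rewrite /ev eval_esum big_map big_enum /= /rank_fun.
rewrite (big_morph _ PoszD (erefl _)); apply: eq_bigr => j _.
by rewrite eval_mulc -/(ev st _) h PoszM.
Qed.

Lemma ev_target st : ev st target_e = (rank k)%:Z.
Proof. by apply: ev_rank => j; rewrite ev_read // ev_const inp_k. Qed.

Lemma ev_dim st j : ev st (dim_e j) = (Defs.dim m n j)%:Z.
Proof.
rewrite /dim_e; have [->|jm] := eqVneq j ord_max; first by rewrite ev_n dim_last.
by rewrite ev_const (dim_local m 1 n jm).
Qed.

Lemma ev_line st ce (j : 'I_d.+1) (e : entry m n) : (forall l, ev st (ce l) = (e l : nat)%:Z) ->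
  ev st (Read j.+1 (line_e j ce)) = sums (j, e).
Proof.
move=> h; rewrite ev_read; last by rewrite /b0 ltnS ltn_ord.
rewrite /sums -inp_sums; congr (inp _ _).
rewrite /ev eval_esum big_map big_enum /= /line_rank.
rewrite (big_morph _ PoszD (erefl _)); apply: eq_bigr => l _.
by rewrite eval_mulc -/(ev st _) h ffunE -PoszM mulnC line_weightE.
Qed.

Lemma along_sum j (e : entry m n) (row : nat -> int) :
  along (@incident _ m n) (j, e) (table row) =
  \sum_(0 <= t < Defs.dim m n j) row (rank_fun (fun l => if l == j then t else e l)).
Proof.
have lt (t : 'I_(Defs.dim m n j)) l : ((if l == j then t : nat else e l) < Defs.dim m n l)%N.
  by case: eqP => [->|_].
rewrite big_mkord /along (reindex_onto (fun t => entry_of (lt t)) (fun e' => e' j)) /=.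
  apply: eq_big => [t|t _].
    rewrite /incident on_line_restr /=; apply/andP; split.
      by apply/forallP => l; apply/implyP => /negPf lj; rewrite -val_eqE /= ffunE /= lj.
    by rewrite ffunE -val_eqE /= eqxx.
  rewrite ffunE /rank; congr (row _); apply: eq_bigr => l _.
  by rewrite ffunE.
move=> e'; rewrite /incident on_line_restr /= => /forallP h.
apply: entry_ext => l; rewrite ffunE /=; case: eqP => [->//|/eqP lj].
by have := implyP (h l) lj => /eqP->.
Qed.

Definition sum_dirty (c a : nat) := (c == vars) && (a \in [:: vAcc; vPos; vSum]).

Lemma sum_dirty_obj c a : sum_dirty c a -> obj_dirty c a.
Proof.
rewrite /sum_dirty /obj_dirty !inE => /andP[-> /=].
by case/or3P=> ->; rewrite ?orbT.
Qed.

Lemma run_add_abs st e :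
  run (add_abs e) st 2 (fun st' => st' = upd st vars vAcc (st vars vAcc + `|ev st e|)).
Proof.
apply: run_if => h; apply: run_set; rewrite ev_op ev_cell /=.
  by rewrite gtr0_norm.
by rewrite ler0_norm.
Qed.

Lemma run_add_neg st e :
  run (add_neg e) st 2
    (fun st' => frame sum_dirty st st' /\ st' vars vAcc = st vars vAcc + neg_part (ev st e)).
Proof.
apply: run_if => h.
  by apply: run_skip; rewrite /neg_part ltNge (ltW h) addr0.
apply: run_set; split; first exact: frame_upd.
rewrite upd_same ev_op ev_cell /= /neg_part; case: ltgtP h => // ->.
by rewrite subr0.
Qed.

Definition line_steps : nat :=
  (1 + (2 + (\sum_j Defs.dim m 1 j) * n * 3 + 2))%N.

Lemma run_add_line st ce j (e : entry m n) :
  (forall st' l, frame sum_dirty st st' -> ev st' (ce l) = (e l : nat)%:Z) ->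
  run (add_line ce j) st line_steps (fun st' => frame sum_dirty st st' /\
    st' vars vAcc = st vars vAcc + `|(sums (j, e) %/ st vars vDiv)%Z
                    - along (@incident _ m n) (j, e) (table (st trial))|).
Proof.
move=> hce; apply: run_seq.
  by apply: (run_set (R := fun st' => st' = upd st vars vSum 0)).
move=> _ ->; rewrite along_sum.
pose F t := st trial (rank_fun (fun l => if l == j then t else (e l : nat))).
pose I (i : nat) (st' : wstate) := [/\ frame sum_dirty st st', st' vars vAcc = st vars vAcc
  & st' vars vSum = \sum_(0 <= t < i) F t].
apply: (@run_seq _ _ _ _ _ _ _ (I (Defs.dim m n j))).
  apply: (@run_weak _ _ _ _ (2 + Defs.dim m n j * 3) (I (Defs.dim m n j))) => //; last first.
    rewrite leq_add2l leq_mul2r (leq_trans (dim_le j)) //.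
    by rewrite leq_mul2r (bigD1 j) //= leq_addr orbT.
  apply: (run_for (I := I)) => // [i st' _||i st' lt [f' a' s'] hi].
  - exact: ev_dim.
  - by split; rewrite ?big_geq //; do 2![apply: frame_upd => //].
  apply: run_set; rewrite upd_other //; split=> //; split=> //.
  - by do 2![apply: frame_upd => //].
  rewrite upd_other // upd_same ev_op ev_cell s' /= big_nat_recr //=.
  rewrite (ev_rd _ (q := rank_fun (fun l => if l == j then i else (e l : nat)))) ?f' //.
  by apply: ev_rank => l; case: eqP => _; rewrite ?ev_cell ?hi ?hce.
move=> st' [f' a' s']; apply: run_post (run_add_abs _ _) _ => st2 ->.
split; first exact: frame_upd.
by rewrite upd_same !ev_op !ev_cell /= (@ev_line _ _ _ e) ?s' ?a' ?f' // => l; apply: hce.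
Qed.

Lemma run_seqs (T : Type) (f : T -> prog) (F : T -> int) (ts : seq T) U st :
  (forall t st', frame sum_dirty st st' -> run (f t) st' U
     (fun st2 => frame sum_dirty st' st2 /\ st2 vars vAcc = st' vars vAcc + F t)) ->
  run (seqs (map f ts)) st (1 + size ts * U) (fun st' =>
     frame sum_dirty st st' /\ st' vars vAcc = st vars vAcc + \sum_(t <- ts) F t).
Proof.
move=> hf; have gen st1 : frame sum_dirty st st1 ->
    run (seqs (map f ts)) st1 (1 + size ts * U) (fun st' => frame sum_dirty st1 st' /\
      st' vars vAcc = st1 vars vAcc + \sum_(t <- ts) F t); last by apply: gen.
elim: ts st1 => [|t ts IH] st1 f1 /=.
  by apply: run_skip; rewrite big_nil addr0.
rewrite mulSn addnCA; apply: run_seq; first exact: hf.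
move=> st2 [f2 a2]; have f12 : frame sum_dirty st st2 by apply: frame_trans f1 f2.
apply: run_post (IH st2 f12) _ => st3 [f3 a3].
split; first exact: frame_trans f2 f3.
by rewrite a3 a2 big_cons addrA.
Qed.

Definition entry_term (Q : int) (x : {ffun entry m n -> int}) (e : entry m n) : int :=
  neg_part (x e) +
  \sum_j `|(sums (j, e) %/ Q)%Z - along (@incident _ m n) (j, e) x|.

Lemma obj_entry_term Q x : obj Q x = \sum_e entry_term Q x e.
Proof.
rewrite big_split /= exchange_big pair_big /=; congr (_ + _).
Qed.

Definition entry_steps : nat := (2 + (1 + d.+1 * line_steps))%N.

Lemma run_add_entry st a (i : 'I_n) : st vars vSlice = (i : nat)%:Z ->
  run (add_entry a) st entry_steps (fun st' => frame sum_dirty st st' /\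
    st' vars vAcc = st vars vAcc
      + entry_term (st vars vDiv) (table (st trial)) (glue (a, i))).
Proof.
move=> hi; set e := glue (a, i).
have hce st' l : frame sum_dirty st st' -> ev st' (coord_e a l) = (e l : nat)%:Z.
  move=> f; rewrite ffunE /= /coord_e /glue_fun.
  by case: eqP => _; rewrite ?ev_cell ?f ?hi.
apply: run_seq; first exact: run_add_neg.
move=> st1 [f1 a1].
apply: (@run_weak _ _ _ _ (1 + size (enum 'I_d.+1) * line_steps)); [|by rewrite size_enum_ord|].
  apply: (run_seqs (F := fun j => `|(sums (j, e) %/ st vars vDiv)%Z
                    - along (@incident _ m n) (j, e) (table (st trial))|)).
  move=> j st' f'; have f2 : frame sum_dirty st st' by apply: frame_trans f1 f'.
  apply: run_post (run_add_line j (e := e) _) _ => [st2 l f3|st2 [f3 a3]].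
    by apply: hce; apply: frame_trans f2 f3.
  have row : st' trial = st trial by apply: functional_extensionality => q; apply: f2.
  by split=> //; rewrite a3 row (f2 vars vDiv).
move=> st' [f' a']; split; first by apply: frame_trans f1 f'.
rewrite a' a1 big_enum /= -addrA; congr (_ + (_ + _)).
by rewrite (ev_rd _ (ev_rank (fun j => hce st j _))) // ffunE.
Qed.

Definition obj_steps : nat :=
  (1 + (2 + n * (1 + #|entry m 1| * entry_steps).+2))%N.

Lemma run_eval_obj st : run eval_obj st obj_steps
  (fun st' => frame obj_dirty st st' /\ st' vars vAcc = obj (st vars vDiv) (table (st trial))).
Proof.
apply: run_seq; first by apply: (run_set (R := fun st' => st' = upd st vars vAcc 0)).
move=> _ ->; set Q := st vars vDiv; set x := table (st trial).
pose F i : int := if insub i is Some i' then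
  \sum_a entry_term Q x (glue (a, i' : 'I_n)) else 0.
pose I i (st' : wstate) := frame obj_dirty st st' /\ st' vars vAcc = \sum_(0 <= t < i) F t.
apply: (run_for (I := I)) => [i st' _||i st' lt [f' a'] hi|st' [f' a']].
- exact: ev_n.
- by split; rewrite ?big_geq //; do 2![apply: frame_upd => //].
- apply: (run_weak (U := (1 + size (enum (entry m 1)) * entry_steps)%N)).
  + apply: (run_seqs (F := fun a => entry_term Q x (glue (a, Ordinal lt)))) => a st2 f2.
    have f3 : frame obj_dirty st st2.
      exact: frame_trans sum_dirty_obj f' f2.
    have hi2 : st2 vars vSlice = (Ordinal lt : nat)%:Z by rewrite f2.
    apply: run_post (run_add_entry a hi2) _ => st3 [f4 a4]; split=> //.
    have row : st2 trial = st trial by apply: functional_extensionality => q; apply: f3.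
    by rewrite a4 row (f3 vars vDiv).
  + by rewrite cardE.
  move=> st2 [f2 a2]; split; first by rewrite f2.
  split.
    apply: frame_upd => //; exact: frame_trans sum_dirty_obj f' f2.
  rewrite upd_other // a2 a' big_nat_recr //=; congr (_ + _).
  by rewrite /F insubT big_enum.
split=> //; rewrite a' big_mkord obj_entry_term (sum_glue (R := int) predT) exchange_big.
by apply: eq_bigr => i _; rewrite /F valK.
Qed.

End Instance.
End ObjectiveProgram.

(** * Polynomial bounds and the main theorem *)
Section PolynomialBounds.
Local Open Scope nat_scope.

(** The two arguments stand for the number of slices and the binary length of
    the line-sums. *)
Definition poly_bounded (F : nat -> nat -> nat) : Prop :=
  exists C e, forall n l, 0 < n -> F n l <= C * (n + l) ^ e.

Lemma pb_le G F : poly_bounded G -> (forall n l, 0 < n -> F n l <= G n l) ->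
  poly_bounded F.
Proof.
move=> [C [e h]] le; exists C, e => n l n0.
by apply: leq_trans (le _ _ n0) (h _ _ n0).
Qed.

Lemma pb_const c : poly_bounded (fun _ _ => c).
Proof. by exists c, 0 => n l _; rewrite expn0 muln1. Qed.

Lemma pb_fst : poly_bounded (fun n _ => n).
Proof. by exists 1, 1 => n l _; rewrite mul1n expn1 leq_addr. Qed.

Lemma pb_snd : poly_bounded (fun _ l => l).
Proof. by exists 1, 1 => n l _; rewrite mul1n expn1 leq_addl. Qed.

Lemma pb_add F G : poly_bounded F -> poly_bounded G ->
  poly_bounded (fun n l => F n l + G n l).
Proof.
move=> [C [e hF]] [C' [e' hG]]; exists (C + C'), (e + e') => n l n0.
have N0 : 0 < n + l by rewrite addn_gt0 n0.
rewrite mulnDl leq_add //; [apply: leq_trans (hF _ _ n0) _|apply: leq_trans (hG _ _ n0) _];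
  by rewrite leq_mul2l leq_pexp2l ?leq_addr ?leq_addl ?orbT.
Qed.

Lemma pb_mul F G : poly_bounded F -> poly_bounded G ->
  poly_bounded (fun n l => F n l * G n l).
Proof.
move=> [C [e hF]] [C' [e' hG]]; exists (C * C'), (e + e') => n l n0.
by rewrite expnD mulnACA leq_mul ?hF ?hG.
Qed.

Lemma pb_succ F : poly_bounded F -> poly_bounded (fun n l => (F n l).+1).
Proof. exact: pb_add (pb_const 1). Qed.

End PolynomialBounds.

Ltac poly_bound := repeat first
  [ eassumption | apply: pb_const | apply: pb_fst | apply: pb_snd | apply: pb_succ
  | apply: pb_add | apply: pb_mul ].

Lemma pb_solve_steps (E C : nat -> finType) (N0 obj_time J : nat -> nat -> nat) B :
  poly_bounded N0 -> poly_bounded obj_time -> poly_bounded J ->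
  poly_bounded (fun n _ => #|E n|) -> poly_bounded (fun n _ => #|C n|) ->
  poly_bounded (fun n l => solve_steps (E n) (C n) (N0 n l) (obj_time n l) B (J n l)).
Proof.
move=> hN hU hJ hE hC.
have hS : poly_bounded (fun n l => search_steps (N0 n l) (obj_time n l) B).
  by elim: B => [|B IH]; rewrite /= /probe_steps; poly_bound.
by rewrite /solve_steps /scale_steps /descend_steps /round_steps /gap; poly_bound.
Qed.

Lemma pb_total U K D : poly_bounded U -> poly_bounded (fun n l =>
  U n l * (K * (1 + (n + (D * n + l)) + K * U n l)))%N.
Proof. by move=> hU; poly_bound. Qed.

Lemma mulfree_mulc c e : mulfree e -> mulfree (mulc c e).
Proof. by move=> he; elim: c => //= c ->; rewrite he. Qed.

Lemma mulfree_esum es : all mulfree es -> mulfree (esum es).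
Proof. by elim: es => //= e es IH /andP[-> /IH->]. Qed.

Lemma pmulfree_seqs ps : all pmulfree ps -> pmulfree (seqs ps).
Proof. by elim: ps => //= p ps IH /andP[-> /IH->]. Qed.

Lemma pmulfree_solve b0 se te o B : mulfree se -> mulfree te -> pmulfree o ->
  pmulfree (solve b0 se te o B).
Proof.
move=> hs ht ho; have hB : pmulfree (search b0 se te o B).
  by elim: B => [|g IH] /=; rewrite ?IH ?ho hs ?ht.
by rewrite /= hB ho hs.
Qed.

Section Main.
Variables (d : nat) (m : d.-tuple nat).

Lemma mulfree_rank (ce : 'I_d.+1 -> expr) :
  (forall j, mulfree (ce j)) -> mulfree (rank_e m ce).
Proof.
move=> h; apply: mulfree_esum; rewrite all_map; apply/allP => j _ /=.
exact: mulfree_mulc.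
Qed.

Lemma mulfree_line j (ce : 'I_d.+1 -> expr) :
  (forall j, mulfree (ce j)) -> mulfree (line_e m j ce).
Proof.
move=> h; apply: mulfree_esum; rewrite all_map; apply/allP => l _ /=.
exact: mulfree_mulc.
Qed.

Lemma mulfree_size : mulfree (size_e m).
Proof. exact: mulfree_mulc. Qed.

Lemma mulfree_target : mulfree (target_e m).
Proof. exact: mulfree_rank. Qed.

Lemma pmulfree_eval_obj : pmulfree (eval_obj m).
Proof.
suff h : pmulfree (seqs [seq add_entry a | a <- enum (entry m 1)]) by rewrite /= h.
apply: pmulfree_seqs; rewrite all_map; apply/allP => a _ /=.
have ca j : mulfree (coord_e a j) by rewrite /coord_e; case: eqP.
suff h : pmulfree (seqs [seq add_line m (coord_e a) j | j <- enum 'I_d.+1]).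
  by rewrite /= h !mulfree_rank.
apply: pmulfree_seqs; rewrite all_map; apply/allP => j _ /=.
have cj : mulfree (rank_e m (fun l => if l == j then var d.+2 vPos else coord_e a l)).
  by apply: mulfree_rank => l; case: eqP.
have cd : mulfree (dim_e m j) by rewrite /dim_e; case: eqP.
by rewrite /= cj cd !mulfree_line.
Qed.

(** Every line passes through some entry, because all ranges are nonempty; so the
    terms of [obj 1] indexed by entries see all line-sum equations. *)
Lemma unique_at_entry n (v : line_sums m n) (k : entry m n)
    (hm : forall j : 'I_d, (0 < tnth m j)%N) (hn : (0 < n)%N) :
  unique_at (@incident _ m n) (sums v) k 1 <-> entry_unique v k.
Proof.
have dim_gt0 j : (0 < Defs.dim m n j)%N.
  have [->|jm] := eqVneq j ord_max; first by rewrite dim_last.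
  rewrite /Defs.dim; have [j' ->|e] := unliftP ord_max j; last by rewrite e eqxx in jm.
  rewrite (tnth_nth 0%N) nth_rcons size_tuple lift_max ltn_ord -tnth_nth.
  exact: hm.
have lineP (j : 'I_d.+1) (r : line m n j) : exists e, r = restr j e.
  pose f l := if unlift j l is Some l' then nat_of_ord (r l') else 0%N.
  have hf l : (f l < Defs.dim m n l)%N.
    by rewrite /f; case: (unliftP j l) => [l' ->|->].
  exists (entry_of hf); apply/ffunP => l; apply: val_inj.
  by rewrite !ffunE /= /f liftK.
have feasible (x : entry m n -> nat) : has_line_sums v x ->
    obj (@incident _ m n) (sums v) 1 [ffun e => (x e)%:Z] = 0.
  move=> hx; apply/obj_eq0; split=> [e|[j e]]; first by rewrite ffunE.
  by rewrite /sums -hx; apply: eq_bigr => e' _; rewrite ffunE.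
have table_of (a : {ffun entry m n -> int}) : obj (@incident _ m n) (sums v) 1 a = 0 ->
    has_line_sums v (fun e => `|a e|%N) /\ forall e, (`|a e|%N)%:Z = a e.
  move=> /obj_eq0[a0 al]; have abs e : (`|a e|%N)%:Z = a e by rewrite gez0_abs.
  split=> // j r; have [e ->] := lineP j r; rewrite -[RHS](al (j, e)).
  by apply: eq_bigr => e' _; rewrite abs.
split=> [u x y hx hy|u a b /table_of[ha ea] /table_of[hb eb]].
  by have := u _ _ (feasible _ hx) (feasible _ hy); rewrite !ffunE => -[].
by rewrite -ea -eb (u _ _ ha hb).
Qed.

Lemma blen_line n (v : line_sums m n) j (r : line m n j) :
  (blen (v j r) <= line_sums_length v)%N.
Proof.
rewrite /line_sums_length (bigD1 j) //= (bigD1 r) //= -addnA.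
exact: leq_addr.
Qed.

Definition dim_sum : nat := (\sum_j Defs.dim m 1 j)%N.

Lemma dim_le_sum n (j : 'I_d.+1) : (0 < n)%N -> (Defs.dim m n j <= dim_sum * n)%N.
Proof.
move=> n0; apply: leq_trans (dim_le m n0 j) _.
by rewrite leq_mul2r /dim_sum (bigD1 j) //= leq_addr orbT.
Qed.

Lemma blen_nat q : (blen q%:Z <= q.+1)%N.
Proof. by rewrite blen_le /= ltn_expl. Qed.

Lemma bits_input n (v : line_sums m n) (k : entry m n) : (0 < n)%N ->
  bits (input v k) (1 + (n + (dim_sum * n + line_sums_length v))).
Proof.
move=> n0 [|b] a; rewrite /input.
  case: a => [[|a]|a] //=; first by apply: leq_trans (blen_nat n) _; lia.
  have [lt|ge] := ltnP a d.+1; last first.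
    by rewrite nth_default ?size_map -?enumT ?size_enum_ord.
  rewrite (nth_map ord0) ?size_enum_ord //.
  have := ltn_ord (k (nth ord0 (enum 'I_d.+1) a)).
  move/leq_trans/(_ (dim_le_sum _ n0)).
  move: (nat_of_ord _) (dim_sum * n)%N => q M lt'.
  by apply: leq_trans (blen_nat q) _; lia.
case: insubP => [j _ _|_] //; case: pickP => // r _.
by apply: leq_trans (blen_line v r) _; lia.
Qed.

Lemma sum_lt_exp (C : finType) (F : C -> int) l : (forall c, F c <= (2 ^ l)%N%:Z) ->
  \sum_c F c < (2 ^ (#|C| + l))%N%:Z.
Proof.
move=> le; apply: le_lt_trans (ler_sum _ (fun c _ => le c)) _.
have : (0 < 2 ^ l)%N by rewrite expn_gt0.
rewrite expnD; move: (2 ^ l)%N => M M0.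
rewrite sumr_const -mulr_natr natz -PoszM ltz_nat mulnC ltn_pmul2r //.
exact: ltn_expl.
Qed.

(** The number of doublings of the divisor is at most the exponent here. *)
Lemma obj0_bound n (v : line_sums m n) :
  obj (@incident _ m n) (sums v) 1 0 <
    (2 ^ (#|{: 'I_d.+1 * entry m n}| + line_sums_length v))%N%:Z.
Proof.
set C := ('I_d.+1 * entry m n)%type.
rewrite /obj big1 ?add0r => [|e _]; last by rewrite /neg_part ffunE.
have le c : `|(sums v c %/ 1)%Z - along (@incident _ m n) c 0| <=
    (2 ^ line_sums_length v)%N%:Z.
  rewrite /along big1 => [|e _]; last by rewrite ffunE.
  rewrite subr0 divz1; have := blen_line v (restr c.1 c.2).
  rewrite -/(sums v c) => /leqW; rewrite blen_le.
  by move: (sums v c) (2 ^ _)%N => z M; lia.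
exact: sum_lt_exp le.
Qed.

End Main.

Theorem theorem2p5 (d : nat) (m : d.-tuple nat)
    (hd : (0 < d)%N) (hm : forall j : 'I_d, (0 < tnth m j)%N) :
  exists (p : prog) (C e : nat),
    forall (n : nat) (hn : (0 < n)%N) (v : line_sums m n) (k : entry m n),
      exists (t : nat) (s : store),
        [/\ exec p (input v k) t s,
            (t <= C * (n + line_sums_length v) ^ e)%N
          & accepts s <-> entry_unique v k].
Proof.
have [B short] := short_moves m.
pose p := Seq (solve d.+2 (size_e m) (target_e m) (eval_obj m) B)
  (Write 0 (Const 0) (Op Defs.Sub (Const 1) (var d.+2 vFlag))).
have mp : pmulfree p.
  apply/andP; split=> //.
  exact: pmulfree_solve (mulfree_size m) (mulfree_target m) (pmulfree_eval_obj m).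
pose U n l := (solve_steps (entry m n) ('I_d.+1 * entry m n)%type (cells m n) (obj_steps m n) B
  (#|{: 'I_d.+1 * entry m n}| + l) + 1)%N.
pose L n l := (1 + (n + (dim_sum m * n + l)))%N.
pose K := psize p.
have [C [e hCe]] : poly_bounded (fun n l => U n l * (K * (L n l + K * U n l)))%N.
  have hcells : poly_bounded (fun n _ => cells m n) by rewrite /cells; poly_bound.
  have hE : poly_bounded (fun n _ => #|entry m n|).
    apply: pb_le hcells _ => n _ n0; rewrite -[cells m n]card_ord.
    apply: (leq_card (fun e => Ordinal (rank_lt n0 e))) => e1 e2 [].
    exact: rank_inj.
  have hC : poly_bounded (fun n _ => #|{: 'I_d.+1 * entry m n}|).
    apply: pb_le (pb_mul (pb_const d.+1) hE) _ => n _ _.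
    by rewrite card_prod card_ord.
  have hobj : poly_bounded (fun n _ => obj_steps m n).
    by rewrite /obj_steps /entry_steps /line_steps; poly_bound.
  apply: pb_total; apply: pb_add (pb_const 1).
  by apply: pb_solve_steps => //; poly_bound.
exists p, C, e => n n0 v k; set l := line_sums_length v.
have := @run_solve (input v k) d.+2 (size_e m) (target_e m) (eval_obj m)
  (entry m n) ('I_d.+1 * entry m n)%type (@incident _ m n) (sums v) (@rank _ m n)
  (cells m n) (obj_steps m n) k (@rank_inj _ m n) (rank_lt n0) (ev_size v k)
  (ev_target v k) (run_eval_obj v k n0) B (@short n) _ (obj0_bound v).
move=> [u [st [xu uU dec]]].
rewrite inp_work in xu.
(* The answer is 1 exactly when the flag is down. *)
have xp : uexec p (input v k) (u + 1) (update (memory (input v k) d.+2 st) 0 0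
    (1 - st vars vFlag)).
  apply: UExecSeq xu _; rewrite -(ev_cell (input v k) d.+2 st vars vFlag).
  exact: (UExecWrite _ _ (Const 0) (Op Defs.Sub (Const 1) (var d.+2 vFlag))).
have [_ [t [xt tle]]] := uexec_exec xp mp (leqnn _) (bits_input v k n0).
exists t, (update (memory (input v k) d.+2 st) 0 0 (1 - st vars vFlag)); split=> //.
  apply: leq_trans tle _; apply: leq_trans (hCe n l n0).
  have uU1 : (u + 1 <= U n l)%N by rewrite /U leq_add2r.
  by rewrite leq_mul // leq_mul2l leq_add2l leq_mul2l uU1 !orbT.
rewrite -(unique_at_entry v k hm n0) /accepts /update /=.
by case: dec => -[-> un]; split=> //; rewrite subrr.
Qed.
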